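(* Let $T>0$, let $g\in L_{2+\varepsilon}[0,1]$ for some $\varepsilon>0$ be a non-decreasing càdlàg function, and let $\{X(u,t),\ u\in(0,1),\ t\in[0,T]\}$ be a process with trajectories in $D((0,1),C[0,T])$ satisfying conditions (C1)–(C4) of the context with initial function $g$. Let $\alpha>\frac12$, $u_0\in(0,1)$, and suppose there exist $C>0$ and $\delta>0$ with $[u_0-\delta,u_0+\delta]\subset(0,1)$ such that (i) $|g(u-\varsigma)-g(u)|\le C|u-u_0|^{(\alpha-1)\vee 0}|\varsigma|^{\alpha\wedge 1}$ for all $u\in[u_0-\delta,u_0+\delta]$ and all $\varsigma$ between $0$ and $u-u_0$; (ii) $|g(u)-g(u_0)|\ge\frac1C|u-u_0|^{\alpha}$ for all $u\in[u_0-\delta,u_0+\delta]$. Then for all $\epsilon>0$ $$\mathbb{P}\left\{\lim_{t\to0}\frac{m(u_0,t)}{t^{\frac{1}{2\alpha+1}}\left(\ln\frac1t\right)^{1+\epsilon}}=0\right\}=1,$$ $$\mathbb{P}\left\{\varlimsup_{t\to0}\frac{|X(u_0,t)-g(u_0)|}{t^{\frac{\alpha}{2\alpha+1}}\left(\ln\frac1t\right)^{-\frac12-\epsilon}}=+\infty\right\}=1.$$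
   Context: $C[0,T]$ is the space of real continuous functions on $[0,T]$ with the uniform norm; $D((0,1),C[0,T])$ is the set of right-continuous functions from $(0,1)$ to $C[0,T]$ having left limits. $\mathrm{Leb}$ is Lebesgue measure, $\mathbb{I}_A$ an indicator, $x\wedge y=\min(x,y)$, $x\vee y=\max(x,y)$, $\inf\emptyset=+\infty$. Conditions on $X$: (C1) for all $u\in(0,1)$, $X(u,\cdot)$ is a continuous square integrable martingale with respect to $\mathcal{F}_t=\sigma(X(u,s),\ s\le t,\ u\in(0,1))$, $t\in[0,T]$; (C2) $X(u,0)=g(u)$ for all $u\in(0,1)$; (C3) $X(u,t)\le X(v,t)$ for all $u<v$ and $t\in[0,T]$; (C4) for all $t\in[0,T]$ and $u,v\in(0,1)$, $\langle X(u,\cdot),X(v,\cdot)\rangle_t=\int_0^t\frac{\mathbb{I}_{\{\tau_{u,v}\le s\}}ds}{m(u,s)}$, where $m(u,t)=\mathrm{Leb}\{w\in(0,1):\ \exists s\le t\ \ X(u,s)=X(w,s)\}$ and $\tau_{u,v}=\inf\{t:\ X(u,t)=X(v,t)\}\wedge T$. *)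

(* Defs.v *)
From HB Require Import structures.
From mathcomp Require Import all_boot all_order all_algebra.
From mathcomp Require Import all_classical all_reals all_analysis.

Set Implicit Arguments.
Unset Strict Implicit.
Unset Printing Implicit Defensive.

Import Order.TTheory GRing.Theory Num.Theory.
Import numFieldNormedType.Exports.

Local Open Scope classical_set_scope.
Local Open Scope ring_scope.

(* Functions of u in (0,1) and t in [0,T] are total functions of real arguments;
   their values outside these intervals are irrelevant. *)

Definition cadlag01 {R : realType} (g : R -> R) : Prop :=
  forall u : R, u \in `]0, 1[ ->
    g v @[v --> u^'+] --> g u /\ cvg (g v @[v --> u^'-]).

Definition nondecreasing01 {R : realType} (g : R -> R) : Prop :=
  {in `]0, 1[ &, {homo g : u v / u <= v}}.

Definition in_Lp01 {R : realType} (p : R) (g : R -> R) : Prop :=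
  measurable_fun (`]0, 1[ : set R) g /\
  (@lebesgue_measure R).-integrable (`]0, 1[ : set R) (fun u => (`|g u| `^ p)%:E).

(* x is in D((0,1), C[0,T]); convergence in C[0,T] is uniform on [0,T]. *)
Definition in_D01C {R : realType} (T : R) (x : R -> R -> R) : Prop :=
  forall u : R, u \in `]0, 1[ ->
  [/\ {within `[0, T], continuous (x u)},
      {uniform `[0, T], x v @[v --> u^'+] --> x u} &
      exists2 y : R -> R, {within `[0, T], continuous y} &
        {uniform `[0, T], x v @[v --> u^'-] --> y}].

Section martingales.
Context {R : realType} (d : measure_display) (Omega : measurableType d).
Variables (P : probability Omega R) (T : R).

Definition sub_measurable (G : set (set Omega)) (Y : Omega -> R) : Prop :=
  forall B : set R, measurable B -> G (Y @^-1` B).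

(* Z is a version of the conditional expectation E[Y | G]. *)
Definition is_cond_exp (G : set (set Omega)) (Y Z : Omega -> R) : Prop :=
  [/\ sub_measurable G Z,
      P.-integrable [set: Omega] (EFin \o Z) &
      forall A : set Omega, G A ->
        (\int[P]_(w in A) (Z w)%:E = \int[P]_(w in A) (Y w)%:E)%E].

Definition adapted (F : R -> set (set Omega)) (M : R -> Omega -> R) : Prop :=
  forall t : R, t \in `[0, T] -> sub_measurable (F t) (M t).

Definition continuous_paths (M : R -> Omega -> R) : Prop :=
  forall w : Omega, {within `[0, T], continuous (fun t => M t w)}.

Definition martingale (F : R -> set (set Omega)) (M : R -> Omega -> R) : Prop :=
  [/\ adapted F M,
      forall t : R, t \in `[0, T] ->
        P.-integrable [set: Omega] (EFin \o M t) &
      forall s t : R, 0 <= s -> s <= t -> t <= T ->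
        is_cond_exp (F s) (M t) (M s)].

Definition square_integrable (M : R -> Omega -> R) : Prop :=
  forall t : R, t \in `[0, T] ->
    P.-integrable [set: Omega] (fun w => ((M t w) ^+ 2)%:E).

Definition augmentation (F : R -> set (set Omega)) (t : R) : set (set Omega) :=
  <<s F t `|` [set N | measurable N /\ P N = 0%E] >>.

(* A is a version of the bracket <M, N> of two continuous square integrable
   F-martingales: the continuous adapted process of finite variation, null at 0,
   such that MN - A is a martingale; it is unique up to indistinguishability.
   The filtration is augmented by the null sets because such an A with all its
   paths continuous need not be adapted to F itself. *)
Definition is_bracket (F : R -> set (set Omega)) (M N A : R -> Omega -> R)
    : Prop :=
  [/\ forall w, A 0 w = 0,
      continuous_paths A,
      forall w, bounded_variation 0 T (fun t => A t w),
      adapted (augmentation F) A &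
      martingale (augmentation F) (fun t w => M t w * N t w - A t w)].

End martingales.

Section coalescing_system.
Context {R : realType} (d : measure_display) (Omega : measurableType d).
Variables (P : probability Omega R) (T : R) (g : R -> R).
Variable X : R -> R -> Omega -> R.

Definition natural_filtration (t : R) : set (set Omega) :=
  <<s [set E | exists u s : R, exists B : set R,
         [/\ u \in `]0, 1[, s \in `[0, t], measurable B &
             E = X u s @^-1` B]] >>.

Definition mass (u t : R) (w : Omega) : \bar R :=
  lebesgue_measure [set v : R | (v \in `]0, 1[) /\
    exists s : R, s \in `[0, t] /\ X u s w = X v s w].

Definition meeting_time (u v : R) (w : Omega) : \bar R :=
  Order.min
    (ereal_inf [set t%:E | t in [set t : R | t \in `[0, T] /\
                                             X u t w = X v t w]])
    T%:E.

Definition C1 : Prop := forall u : R, u \in `]0, 1[ ->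
  [/\ martingale P T natural_filtration (X u),
      continuous_paths T (X u) &
      square_integrable P T (X u)].

Definition C2 : Prop := forall u : R, u \in `]0, 1[ ->
  {ae P, forall w, X u 0 w = g u}.

Definition C3 : Prop := forall u v t : R,
  u \in `]0, 1[ -> v \in `]0, 1[ -> u < v -> t \in `[0, T] ->
  {ae P, forall w, X u t w <= X v t w}.

(* The inverse is the one of \bar R, so that 0^-1 = +oo (and 0 * +oo = 0). *)
Definition C4 : Prop := forall u v : R, u \in `]0, 1[ -> v \in `]0, 1[ ->
  exists2 A : R -> Omega -> R,
    is_bracket P T natural_filtration (X u) (X v) A &
    forall t : R, t \in `[0, T] -> {ae P, forall w,
      ((A t w)%:E = \int[lebesgue_measure]_(s in `[0%R, t])
         ((\1_[set r : R | (meeting_time u v w <= r%:E)%E] s)%:E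
            * (mass u s w)^-1))%E}.

End coalescing_system.

(* Main.v *)
(* For a particle u and a neighbour v at distance rho, let Z = X(v) - X(u) and let
   B be its bracket, which grows at rate at least 1/m(u) until u and v meet, while
   m(u) >= rho afterwards; hence <X(u)>_t >= 2b forces B_t >= b as soon as
   t <= b rho. A nonnegative martingale started at x satisfies
   P(B_t >= b) <= 3 x / sqrt b (stop Z at level sqrt b), and taking rho = t/b with
   the Holder condition (i), whose exponent exceeds 1/2, the tail of <X(u)>_t is
   integrable: E <X(u)>_t <= C (t/r + r^(alpha-1/2) sqrt t) for u within r of u0.

   By (ii) the particle u0 +- r starts at distance at least r^alpha / C from u0, so
   Kolmogorov's inequality bounds the probability that they meet before t by
   C (q^2 + q) with q^2 = t / r^(2 alpha + 1). For t = 2^-k and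
   r = t^(1/(2 alpha + 1)) k^(1+eps) this is summable and Borel-Cantelli gives the
   upper bound on m(u0, t).

   Consequently <X(u0)>_t is eventually at least
   b(t) = t^(2 alpha/(2 alpha + 1)) ln(1/t)^(-1-eps), whereas
   P(<X(u0)>_t >= b, |X(u0) - g(u0)| <= a on [0, t]) <= 4 a^2 / b. Borel-Cantelli
   along t = exp(-2^k) then forces X(u0) to leave the required intervals.

   Martingales are only tested against events of the natural filtration, at the
   dyadic points of [0, t]. *)
Require Import Defs.
From mathcomp Require Import all_boot all_order all_algebra.
From mathcomp Require Import all_classical all_reals all_analysis.
From mathcomp Require Import measurable_realfun.
From mathcomp Require Import ring lra.
Import Order.TTheory GRing.Theory Num.Theory.
Import numFieldNormedType.Exports.
Local Open Scope classical_set_scope.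
Local Open Scope ring_scope.

Set Implicit Arguments.
Unset Strict Implicit.
Unset Printing Implicit Defensive.

(** * Expectations *)

(** The natural filtration need not be complete or right-continuous, the brackets are adapted only
    to its augmentation, and (C4) identifies them almost surely at each fixed time only. Finite
    grids avoid hitting times: the stopping rules look at the martingale alone, so they are events
    of the natural filtration, and the compensator enters only through integrals and almost sure
    inequalities at finitely many times. The price is an overshoot, since on a grid a path may jump
    past its level. A large overshoot needs a large increment between neighbouring grid points;
    uniform continuity makes such paths disappear in the limit, so allowing a value [2 * a] instead
    of [a] is enough, whence the constants 3 and 4. The exponent 1/2: with [b = t / rho], the
    quantity [b * rho ^ beta / sqrt b] equals [sqrt t * rho ^ (beta - 1/2)], summable over dyadic
    [rho] exactly when [beta > 1/2]. Kolmogorov's inequality needs the brackets at both ends of the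
    pair, so (i) is used at [u0] and at [u0 +- r]; its two exponents add up to [alpha], the exponent
    of (ii). *)

Section expectations.
Context {R : realType} (d : measure_display) (Omega : measurableType d).
Variable P : probability Omega R.

Local Notation integ f := (P.-integrable [set: Omega] (EFin \o f)).

Lemma integ_sub (E : set Omega) (f : Omega -> R) :
  measurable E -> integ f -> P.-integrable E (EFin \o f).
Proof. by move=> mE; apply: integrableS. Qed.

Lemma integ_measurable (f : Omega -> R) : integ f -> measurable_fun setT f.
Proof. by move=> /measurable_int /measurable_EFinP. Qed.

Lemma integD (f g : Omega -> R) :
  integ f -> integ g -> integ (fun w => f w + g w).
Proof.
move=> hf hg; have -> : EFin \o (fun w => f w + g w) =
  ((EFin \o f) \+ (EFin \o g))%E by apply/funext => w.
exact: integrableD.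
Qed.

Lemma integZ (c : R) (f : Omega -> R) : integ f -> integ (fun w => c * f w).
Proof.
move=> hf; have -> : EFin \o (fun w => c * f w) =
  (fun w => c%:E * (EFin \o f) w)%E by apply/funext => w.
exact: integrableZl.
Qed.

Lemma integB (f g : Omega -> R) :
  integ f -> integ g -> integ (fun w => f w - g w).
Proof.
move=> hf hg; have -> : (fun w => f w - g w) = (fun w => f w + (-1) * g w).
  by apply/funext => w; rewrite mulN1r.
by apply: integD => //; apply: integZ.
Qed.

Lemma integ_cst (c : R) : integ (fun=> c).
Proof. exact: finite_measure_integrable_cst. Qed.

Lemma integ_mulind (E : set Omega) (f : Omega -> R) :
  measurable E -> integ f -> integ (fun w => f w * \1_E w).
Proof.
move=> mE hf; apply: (le_integrable measurableT _ _ hf) => //.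
- apply/measurable_EFinP; apply: measurable_funM; first exact: integ_measurable.
  exact: measurable_indic.
- move=> w _ /=; rewrite lee_fin normrM -[leRHS]mulr1 ler_wpM2l//.
  by rewrite indicE; case: (_ \in _); rewrite ?normr1 ?normr0.
Qed.

Lemma integ_ind (E : set Omega) : measurable E -> integ (\1_E : Omega -> R).
Proof.
move=> mE; have -> : (\1_E : Omega -> R) = (fun w => 1 * \1_E w).
  by apply/funext => w; rewrite mul1r.
by apply: integ_mulind => //; exact: integ_cst.
Qed.

Lemma Rintegral_ind (E D : set Omega) : measurable E -> measurable D ->
  \int[P]_(w in D) (\1_E w : R) = fine (P (E `&` D)).
Proof. by move=> mE mD; rewrite /Rintegral integral_indic. Qed.

Lemma Rintegral_mulind (E D : set Omega) (f : Omega -> R) :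
  \int[P]_(w in D) (f w * \1_E w) = \int[P]_(w in D `&` E) f w.
Proof.
rewrite Rintegral_mkcondr; congr Rintegral; apply/funext => w.
by rewrite patchE indicE; case: ifP => _; rewrite ?mulr1 ?mulr0.
Qed.

Lemma ae_Rintegral_ge0 (D : set Omega) (f : Omega -> R) :
  measurable D -> integ f ->
  {ae P, forall w, 0 <= f w} -> 0 <= \int[P]_(w in D) f w.
Proof.
move=> mD hf f0.
have -> : \int[P]_(w in D) f w = \int[P]_(w in D) Num.max (f w) 0.
  rewrite /Rintegral; congr fine; apply: ae_eq_integral => //.
  - apply: measurable_funS (measurable_int _ hf) => //.
  - apply/measurable_EFinP.
    apply: measurable_funS (_ : measurable_fun setT _) => //.
    by apply: measurable_maxr => //; exact: integ_measurable.
  - by apply: filterS f0 => w fw _; rewrite max_l.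
by apply: Rintegral_ge0 => w _; rewrite le_max lexx orbT.
Qed.

Lemma ae_le_Rintegral (D : set Omega) (f1 f2 : Omega -> R) :
  measurable D -> integ f1 -> integ f2 ->
  {ae P, forall w, f1 w <= f2 w} ->
  \int[P]_(w in D) f1 w <= \int[P]_(w in D) f2 w.
Proof.
move=> mD h1 h2 h12; rewrite -subr_ge0 -RintegralB//; try exact: integ_sub.
apply: ae_Rintegral_ge0 => //; first exact: integB.
by apply: filterS h12 => w; rewrite subr_ge0.
Qed.

Lemma ae_eq_Rintegral (D : set Omega) (f1 f2 : Omega -> R) :
  measurable D -> integ f1 -> integ f2 ->
  {ae P, forall w, f1 w = f2 w} ->
  \int[P]_(w in D) f1 w = \int[P]_(w in D) f2 w.
Proof.
move=> mD h1 h2 h12; apply/eqP; rewrite eq_le !ae_le_Rintegral//;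
  by apply: filterS h12 => w ->.
Qed.

Lemma Rintegral_prob (D : set Omega) (c : R) : measurable D ->
  \int[P]_(w in D) c = c * fine (P D).
Proof. by move=> mD; rewrite Rintegral_cst. Qed.

Lemma markov_fine (E : set Omega) (f : Omega -> R) (b : R) : measurable E ->
  integ f -> (forall w, E w -> b <= f w) ->
  b * fine (P E) <= \int[P]_(w in E) f w.
Proof.
move=> mE hf hb; rewrite -Rintegral_prob//; apply: le_Rintegral => //.
- exact: integ_sub (integ_cst _).
- exact: integ_sub.
Qed.

Lemma fine_le_prob (A B : set Omega) :
  measurable A -> measurable B -> A `<=` B -> fine (P A) <= fine (P B).
Proof.
move=> mA mB AB; rewrite fine_le ?fin_num_measure//.
by rewrite le_measure ?inE.
Qed.

Lemma ae_le_prob (A B : set Omega) : measurable A -> measurable B ->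
  {ae P, forall w, A w -> B w} -> fine (P A) <= fine (P B).
Proof.
move=> mA mB AB; rewrite -(setIT A) -(setIT B) -!Rintegral_ind//.
apply: ae_le_Rintegral => //; try exact: integ_ind.
apply: filterS AB => w AB; rewrite !indicE.
have [Aw|nAw] := pselect (A w); last by rewrite memNset.
by rewrite !mem_set//; exact: AB.
Qed.

Lemma fine_probU (A B : set Omega) :
  measurable A -> measurable B -> fine (P (A `|` B)) <= fine (P A) + fine (P B).
Proof.
move=> mA mB; rewrite -fineD ?fin_num_measure//.
rewrite fine_le ?fin_num_measure//; first exact: measurableU.
  by rewrite fin_numD !fin_num_measure.
exact: measureU2.
Qed.

End expectations.

(** * Optional stopping along a finite grid *)

Section discrete_stopping.
Context {R : realType} (d : measure_display) (Omega : measurableType d).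
Variable P : probability Omega R.

Local Notation integ f := (P.-integrable [set: Omega] (EFin \o f)).

(** Adaptedness is not part of this notion: the compensated processes are measurable only for the
    augmented filtration, yet their increments integrate to zero over events of [F]. *)
Definition event_martingale (F : nat -> set (set Omega))
    (M : nat -> Omega -> R) : Prop :=
  (forall i, integ (M i)) /\
  forall i E, F i E -> \int[P]_(w in E) M i.+1 w = \int[P]_(w in E) M i w.

Definition event_filtration (F : nat -> set (set Omega)) : Prop :=
  [/\ forall i E, F i E -> measurable E, forall i, F i setT,
      forall i A B, F i A -> F i B -> F i (A `&` B),
      forall i A, F i A -> F i (~` A) &
      forall i A, F i A -> F i.+1 A].

Lemma event_martingale_cst F (f : Omega -> R) :
  integ f -> event_martingale F (fun=> f).
Proof. by move=> hf; split. Qed.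

Lemma event_martingaleZ F (c : R) M : event_filtration F ->
  event_martingale F M -> event_martingale F (fun i w => c * M i w).
Proof.
move=> [mF _ _ _ _] [iM hM]; split=> [i|i E FE]; first exact: integZ.
have mE := mF _ _ FE.
by rewrite !RintegralZl//; try exact: integ_sub; rewrite hM.
Qed.

Lemma event_martingale_le F M i j E : event_filtration F ->
  event_martingale F M -> F i E -> (i <= j)%N ->
  \int[P]_(w in E) M j w = \int[P]_(w in E) M i w.
Proof.
move=> [mF _ _ _ FS] [iM hM] FE /subnK <-.
have FE' k : F (k + i)%N E by elim: k => //= k; exact: FS.
by elim: (j - i)%N => // k IH; rewrite addSn hM.
Qed.

Variable F : nat -> set (set Omega).
Hypothesis Ffilt : event_filtration F.
Variables (h : nat -> Omega -> R) (a : R).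
Hypothesis h_adapted : forall i, F i [set w | h i w <= a].

Definition below n : set Omega := [set w | forall j, (j < n)%N -> h j w <= a].

(** The event that the first passage of [h] above [a] happens at index [n]. Together with
    [below N.+1], the events [exceed 0], ..., [exceed N] partition the space. *)
Definition exceed n : set Omega := below n `&` [set w | a < h n w].

Let measF i E : F i E -> measurable E.
Proof. by case: Ffilt => mF _ _ _ _; exact: mF. Qed.

Lemma below0 : below 0 = setT.
Proof. by apply/seteqP; split=> w //= _ j. Qed.

Lemma belowS n : below n.+1 = below n `&` [set w | h n w <= a].
Proof.
apply/seteqP; split=> w /= => [hw|[hw hn] j].
  by split=> [j jn|]; apply: hw => //; rewrite ltnS ltnW.
by rewrite ltnS leq_eqVlt => /predU1P[->//|/hw].
Qed.

Lemma F_below n : F n (below n.+1).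
Proof.
case: Ffilt => mF FT FI FC FS; elim: n => [|n IH].
  by rewrite belowS below0 setTI; exact: h_adapted.
by rewrite belowS; apply: FI => //; exact: FS.
Qed.

Lemma F_below' n : F n (below n).
Proof.
case: Ffilt => mF FT FI FC FS; case: n => [|n]; first by rewrite below0.
by apply: FS; exact: F_below.
Qed.

Lemma F_exceed n : F n (exceed n).
Proof.
case: Ffilt => mF FT FI FC FS; apply: FI; first exact: F_below'.
rewrite (_ : [set w | _] = ~` [set w | h n w <= a]); first exact: FC.
by apply/seteqP; split=> w /=; rewrite ltNge => /negP.
Qed.

Lemma measurable_below n : measurable (below n).
Proof. exact: measF (F_below' n). Qed.

Lemma measurable_exceed n : measurable (exceed n).
Proof. exact: measF (F_exceed n). Qed.

Lemma below_split n : below n = exceed n `|` below n.+1.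
Proof.
rewrite belowS /exceed -setIUr; apply/seteqP; split=> w; last by case.
by move=> hw; split=> //=; case: (ltP a (h n w)); [left|right].
Qed.

Lemma Rintegral_below_split n (f : Omega -> R) : integ f ->
  \int[P]_(w in below n) f w =
  \int[P]_(w in exceed n) f w + \int[P]_(w in below n.+1) f w.
Proof.
move=> hf; rewrite {1}below_split Rintegral_setU//.
- exact: measurable_exceed.
- exact: measurable_below.
- apply: integ_sub => //; apply: measurableU; first exact: measurable_exceed.
  exact: measurable_below.
- apply/disj_set2P; apply/seteqP; split=> w //= -[[_ /= hw]].
  by move=> /(_ n (ltnSn n)); rewrite leNgt hw.
Qed.

(** The right-hand side is the expectation of [L] at the first passage, or at [n] if there was none.
    Since [below n.+1] involves only the indices up to [n], it lies in [F n], and the part not yet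
    stopped can be advanced one step. *)
Lemma optional_stopping n L : event_martingale F L ->
  \int[P]_w L 0%N w =
  \sum_(j < n.+1) \int[P]_(w in exceed j) L j w +
  \int[P]_(w in below n.+1) L n w.
Proof.
move=> hL; have [iL mL] := hL; elim: n => [|n IH].
  by rewrite big_ord_recr big_ord0 /= add0r -Rintegral_below_split// below0.
rewrite IH [in RHS]big_ord_recr /= -addrA; congr (_ + _).
by rewrite -(mL n _ (F_below n)); exact: Rintegral_below_split.
Qed.

(** An integrable [f] frozen in time is an event martingale, so optional stopping reduces to the
    partition by first passages. *)
Lemma sum_exceed n (f : Omega -> R) : integ f ->
  \sum_(j < n.+1) \int[P]_(w in exceed j) f w +
  \int[P]_(w in below n.+1) f w = \int[P]_w f w.
Proof. by move=> hf; rewrite -(optional_stopping n (event_martingale_cst F hf)). Qed.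

Lemma prob_exceed n :
  fine (P (~` below n.+1)) = \sum_(j < n.+1) fine (P (exceed j)).
Proof.
have mb := measurable_below n.+1.
have := sum_exceed n (integ_cst P 1).
rewrite !Rintegral_prob// mul1r probability_setT /= mul1r.
rewrite (eq_bigr (fun j : 'I_n.+1 => fine (P (exceed j)))); last first.
  by move=> j _; rewrite Rintegral_prob ?mul1r//; exact: measurable_exceed.
rewrite probability_setC// fineB ?fin_num_measure//= => <-.
by rewrite addrK.
Qed.

Section with_compensator.
Variables Y A : nat -> Omega -> R.
Variable N : nat.
Hypothesis iY : forall i, integ (Y i).
Hypothesis iA : forall i, integ (A i).
Hypothesis YA : event_martingale F (fun i w => Y i w - A i w).
Hypothesis A_le : forall i, (i <= N)%N -> {ae P, forall w, A i w <= A N w}.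
Hypothesis Y0 : forall i, {ae P, forall w, 0 <= Y i w}.

Lemma stopped_compensated :
  \sum_(j < N.+1) \int[P]_(w in exceed j) Y j w +
    \int[P]_(w in below N.+1) Y N w =
  \int[P]_w (Y 0%N w - A 0%N w) +
  \sum_(j < N.+1) \int[P]_(w in exceed j) A j w +
    \int[P]_(w in below N.+1) A N w.
Proof.
rewrite (optional_stopping N YA).
have -> : \sum_(j < N.+1) \int[P]_(w in exceed j) (Y j w - A j w) =
    \sum_(j < N.+1) \int[P]_(w in exceed j) Y j w -
    \sum_(j < N.+1) \int[P]_(w in exceed j) A j w.
  rewrite -sumrB; apply: eq_bigr => j _; have me := measurable_exceed j.
  exact: RintegralB me (integ_sub me (iY j)) (integ_sub me (iA j)).
have mb := measurable_below N.+1.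
rewrite (RintegralB mb (integ_sub mb (iY N)) (integ_sub mb (iA N))).
by lra.
Qed.

(** At a first passage [Y] is at least [c], and the compensator stopped there is almost surely at
    most its terminal value. *)
Lemma maximal_inequality (c : R) :
  (forall i w, a < h i w -> c <= Y i w) -> 
  c * fine (P (~` below N.+1)) <=
  \int[P]_w (Y 0%N w - A 0%N w) + \int[P]_w A N w.
Proof.
move=> hc; rewrite -(sum_exceed N (iA N)) addrA.
have le1 : \sum_(j < N.+1) \int[P]_(w in exceed j) A j w <=
           \sum_(j < N.+1) \int[P]_(w in exceed j) A N w.
  apply: ler_sum => j _; apply: ae_le_Rintegral => //.
    exact: measurable_exceed.
  by apply: A_le; rewrite -ltnS.
have le2 : c * fine (P (~` below N.+1)) <=
           \sum_(j < N.+1) \int[P]_(w in exceed j) Y j w.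
  rewrite prob_exceed mulr_sumr; apply: ler_sum => j _.
  apply: markov_fine => //; first exact: measurable_exceed.
  by move=> w [_ /=]; exact: hc.
have le3 : 0 <= \int[P]_(w in below N.+1) Y N w.
  by apply: ae_Rintegral_ge0 => //; exact: measurable_below.
have := stopped_compensated; lra.
Qed.

(** A bound in the opposite direction: the compensator is controlled by the stopped value of [Y].
    The martingale [L] dominates [Y] while [h <= b]; it is a constant in one application and linear
    in the martingale in the other. First passages that land above [b] are collected in [O]. *)
Lemma stopped_compensator_le (L : nat -> Omega -> R) (b : R) (O : set Omega) :
  event_martingale F L -> (forall i, {ae P, forall w, 0 <= L i w}) ->
  (forall i, {ae P, forall w, h i w <= b -> Y i w <= L i w}) ->
  (forall i, F i [set w | h i w <= b]) -> a <= b ->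
  (forall i, {ae P, forall w, 0 <= A i w}) ->
  0 <= \int[P]_w (Y 0%N w - A 0%N w) ->
  measurable O ->
  (forall i w, (i <= N)%N -> exceed i w -> b < h i w -> O w) ->
  \int[P]_(w in below N.+1) A N w <=
  \int[P]_w L 0%N w + \int[P]_(w in O) Y N w.
Proof.
move=> hL L0 YL hb ab A0 YA0 mO hO.
have [iL mL] := hL; have [mF FT FI FC FS] := Ffilt.
pose B i : set Omega := ~` [set w | h i w <= b].
have FB i : F i (B i) by exact: FC.
have mB i : measurable (B i) by exact: mF (FB i).
have me := measurable_exceed; have mb := measurable_below.
have iYO : integ (fun w => Y N w * \1_O w) by exact: integ_mulind.
have overshoot (j : 'I_N.+1) : \int[P]_(w in exceed j) Y j w <=
    \int[P]_(w in exceed j) L j w + \int[P]_(w in exceed j) (Y N w * \1_O w).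
  have mEB : measurable (exceed j `&` B j) by exact: measurableI.
  have jN : (j <= N)%N by rewrite -ltnS.
  have -> : \int[P]_(w in exceed j) Y j w =
      \int[P]_(w in exceed j) (Y j w * \1_(~` B j) w) +
      \int[P]_(w in exceed j) (Y j w * \1_(B j) w).
    rewrite -RintegralD//.
    - apply: eq_Rintegral => w _; rewrite -mulrDr indicC.
      by rewrite indicE; case: (_ \in _) => /=; rewrite ?add0r ?addr0 mulr1.
    - by apply: integ_sub => //; apply: integ_mulind => //; exact: measurableC.
    - by apply: integ_sub => //; apply: integ_mulind.
  apply: lerD.
    apply: ae_le_Rintegral => //.
      by apply: integ_mulind => //; exact: measurableC.
    apply: filterS2 (YL j) (L0 j) => w h1 h2; rewrite indicE.
    case: (boolP (w \in _)) => [|_]; last by rewrite mulr0.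
    by rewrite inE /B setCK /= mulr1.
  rewrite Rintegral_mulind.
  (* [Y] is a submartingale, so its value at an overshoot is traded for the terminal one. All
     overshoots are then charged to the single integrable function [Y N], as dominated convergence
     will require. *)
  have : \int[P]_(w in exceed j `&` B j) (Y j w - A j w) =
         \int[P]_(w in exceed j `&` B j) (Y N w - A N w).
    by rewrite (event_martingale_le Ffilt YA _ jN)//; apply: FI => //;
       exact: F_exceed.
  rewrite !RintegralB//; try exact: integ_sub.
  have := ae_le_Rintegral mEB (iA j) (iA N) (A_le jN) => le1 eq1.
  apply: (@le_trans _ _ (\int[P]_(w in exceed j `&` B j) Y N w)); first by lra.
  have -> : \int[P]_(w in exceed j `&` B j) Y N w =
            \int[P]_(w in exceed j `&` B j) (Y N w * \1_O w).
    apply: eq_Rintegral => w; rewrite inE => -[ew /= Bw].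
    rewrite indicE mem_set ?mulr1//; apply: hO ew _ => //.
    by rewrite ltNge; apply/negP.
  rewrite -Rintegral_mulind; apply: ae_le_Rintegral => //.
    exact: integ_mulind.
  apply: filterS (Y0 N) => w Yw; rewrite -[leRHS]mulr1; apply: ler_wpM2l.
    by rewrite mulr_ge0.
  by rewrite indicE; case: (_ \in _).
have last_step : \int[P]_(w in below N.+1) Y N w <=
                 \int[P]_(w in below N.+1) L N w.
  have -> : \int[P]_(w in below N.+1) Y N w =
            \int[P]_(w in below N.+1) (Y N w * \1_(below N.+1) w).
    by rewrite Rintegral_mulind setIid.
  apply: ae_le_Rintegral => //; first exact: integ_mulind.
  apply: filterS2 (YL N) (L0 N) => w h1 h2; rewrite indicE.
  case: (boolP (w \in _)) => [|_]; last by rewrite mulr0.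
  by rewrite inE mulr1 => /(_ N (ltnSn N)) hN; apply: h1; exact: le_trans ab.
have sumY : \sum_(j < N.+1) \int[P]_(w in exceed j) Y j w <=
    \sum_(j < N.+1) \int[P]_(w in exceed j) L j w +
    \sum_(j < N.+1) \int[P]_(w in exceed j) (Y N w * \1_O w).
  by rewrite -big_split /=; apply: ler_sum => j _; exact: overshoot.
have sumA : 0 <= \sum_(j < N.+1) \int[P]_(w in exceed j) A j w.
  by apply: sumr_ge0 => j _; exact: ae_Rintegral_ge0.
have YO_ge0 : 0 <= \int[P]_(w in below N.+1) (Y N w * \1_O w).
  apply: ae_Rintegral_ge0 => //; apply: filterS (Y0 N) => w Yw.
  by rewrite mulr_ge0.
have YO_O : \int[P]_w (Y N w * \1_O w) = \int[P]_(w in O) Y N w.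
  by rewrite Rintegral_mulind setTI.
have := sum_exceed N iYO; rewrite YO_O.
have := optional_stopping N hL.
have := stopped_compensated.
lra.
Qed.
End with_compensator.

End discrete_stopping.

(** * Continuous paths on dyadic grids *)

Section paths.
Context {R : realType}.

Lemma within_dist (T : R) (f : R -> R) (x e : R) :
  {within `[0, T], continuous f} -> x \in `[0, T] -> 0 < e ->
  exists2 r, 0 < r & forall y, y \in `[0, T] -> `|x - y| < r -> `|f x - f y| < e.
Proof.
move=> /subspace_continuousP cf xT e0.
have /(@cvgrPdist_lt _ _ _ _ (within_filter _ _)) /(_ e e0) := cf x xT.
rewrite /within/= => -[r /= r0 hr]; exists r => // y yT xy.
by apply: hr => //; rewrite inE in yT.
Qed.

Lemma unif_cont_segment (T : R) (f : R -> R) :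
  {within `[0, T], continuous f} -> forall e, 0 < e ->
  exists2 r, 0 < r & forall x y, x \in `[0, T] -> y \in `[0, T] ->
    `|x - y| < r -> `|f x - f y| < e.
Proof.
move=> cf e e0.
have cpt : compact `[0, T]%classic by exact: segment_compact.
(* Near-covering compactness, for the filter of small positive radii, turns the radii available near
   each point into a single one. *)
have := (compact_near_coveringP `[0, T]%classic).1 cpt R (0^'+)
  (fun r x => forall y, y \in `[0, T] -> `|x - y| < r ->
    x \in `[0, T] -> `|f x - f y| < e) _.
case.
  move=> x xT; have e20 : 0 < e / 2 by rewrite divr_gt0.
  have [r r0 hr] := within_dist cf xT e20.
  exists ([set y | `|x - y| < r / 2], [set s | s < r / 2]).
    split => /=.
      by exists (r / 2) => //=; rewrite divr_gt0.
    exists (r / 2) => /=; first by rewrite divr_gt0.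
    by move=> z /=; rewrite sub0r normrN => + z0; rewrite gtr0_norm.
  move=> [y s] /= [xy sr] z zT yz yT.
  have h1 : `|f x - f y| < e / 2 by apply: hr => //; apply: lt_trans xy _; lra.
  have h2 : `|f x - f z| < e / 2.
    apply: hr => //; rewrite -(subrKA y) (le_lt_trans (ler_normD _ _))//.
    have -> : r = r / 2 + r / 2 by field.
    by rewrite ltrD// (lt_trans yz).
  rewrite -(subrKA (f x)) (le_lt_trans (ler_normD _ _))//.
  have -> : e = e / 2 + e / 2 by field.
  by rewrite ltrD// distrC.
move=> r /= r0 hr; exists (r / 2); first by rewrite divr_gt0.
move=> x y xT yT xy; apply: (hr (r / 2)) => //=.
- by rewrite sub0r normrN gtr0_norm ?divr_gt0//; lra.
- by rewrite divr_gt0.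
Qed.

(** The index is capped at [2 ^ n], so that the grid is a sequence over all naturals that stays at
    [t] once it gets there. *)
Definition grid (t : R) (n j : nat) : R := t * (minn j (2 ^ n))%:R / 2 ^+ n.

Lemma grid0 t n : grid t n 0 = 0.
Proof. by rewrite /grid min0n mulr0 mul0r. Qed.

Lemma grid_last t n : grid t n (2 ^ n) = t.
Proof. by rewrite /grid minnn natrX mulfK// expf_neq0. Qed.

Lemma grid_ge0 t n j : 0 <= t -> 0 <= grid t n j.
Proof. by move=> t0; rewrite /grid divr_ge0 ?mulr_ge0 ?exprn_ge0. Qed.

Lemma grid_mono t n i j : 0 <= t -> (i <= j)%N -> grid t n i <= grid t n j.
Proof.
move=> t0 ij; rewrite /grid ler_wpM2r ?invr_ge0 ?exprn_ge0//.
rewrite ler_wpM2l// ler_nat leq_min geq_minr andbT.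
by rewrite (leq_trans (geq_minl _ _)).
Qed.

Lemma grid_le t n j : 0 <= t -> grid t n j <= t.
Proof.
move=> t0; rewrite /grid -mulrA -[leRHS]mulr1; apply: ler_wpM2l => //.
by rewrite ler_pdivrMr ?exprn_gt0// mul1r -natrX ler_nat geq_minr.
Qed.

Lemma grid_step t n j : 0 <= t -> grid t n j.+1 - grid t n j <= t / 2 ^+ n.
Proof.
move=> t0; rewrite /grid -mulrBl -mulrBr ler_wpM2r ?invr_ge0 ?exprn_ge0//.
rewrite -[leRHS]mulr1; apply: ler_wpM2l => //.
rewrite lerBlDl natr1 ler_nat.
case: (leqP j (2 ^ n)) => jn; last by rewrite geq_min; apply/orP; right; exact: leqnSn.
by rewrite (leq_trans (geq_minl _ _)).
Qed.

Lemma grid_refine t n j : (j <= 2 ^ n)%N -> grid t n j = grid t n.+1 (2 * j).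
Proof.
move=> jn; rewrite /grid (minn_idPl jn) (minn_idPl _) ?expnS ?leq_pmul2l//.
by rewrite natrM exprS; field; rewrite ?expf_neq0.
Qed.

Lemma grid_dense T t (f : R -> R) (c r : R) : 0 <= t <= T ->
  {within `[0, T], continuous f} -> r \in `[0, t] -> c < f r ->
  exists n j, (j <= 2 ^ n)%N /\ c < f (grid t n j).
Proof.
move=> /andP[t0 tT] cf; rewrite in_itv/= => /andP[r0 rt] cr.
have rT : r \in `[0, T] by rewrite in_itv/= r0 (le_trans rt).
have e0 : 0 < f r - c by lra.
have [s s0 hs] := within_dist cf rT e0.
have [n hn] : exists n, t / 2 ^+ n < s.
  exists (Num.bound (t / s)).
  rewrite ltr_pdivrMr ?exprn_gt0// mulrC -ltr_pdivrMr//.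
  have := archi_boundP (divr_ge0 t0 (ltW s0)) => /lt_trans; apply.
  by rewrite -natrX ltr_nat ltn_expl.
have [j jn jr] : exists2 j, (j <= 2 ^ n)%N & grid t n j <= r <= grid t n j + t / 2 ^+ n.
  have : exists j, (r <= grid t n j) by exists (2 ^ n)%N; rewrite grid_last.
  move=> ej; case: (ex_minnP ej) => -[|j] rj jmin.
    exists 0%N => //; move: rj; rewrite grid0 => rj.
    have -> : r = 0 by lra.
    by rewrite lexx add0r divr_ge0 ?exprn_ge0.
  have jn : (j.+1 <= 2 ^ n)%N by apply: jmin; rewrite grid_last.
  exists j; first exact: ltnW.
  have jr : grid t n j < r.
    by rewrite ltNge; apply/negP => /jmin; rewrite ltnn.
  rewrite ltW//=; apply: le_trans rj _.
  by rewrite -lerBlDl grid_step.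
exists n, j; split=> //.
have := hs (grid t n j) _ _.
rewrite in_itv/= grid_ge0//= (le_trans (grid_le _ _ t0))// => /(_ isT).
have : `|r - grid t n j| < s.
  by case/andP: jr => j1 j2; rewrite ger0_norm; lra.
move=> jrs /(_ jrs); move/ltr_normlW; lra.
Qed.

End paths.

(** * Tail bounds for compensators *)

Section overshoot.
Context {R : realType} (d : measure_display) (Omega : measurableType d).
Variable P : probability Omega R.
Local Notation integ f := (P.-integrable [set: Omega] (EFin \o f)).

Variables (T t : R) (h : R -> Omega -> R) (a : R).
Hypothesis tT : 0 <= t <= T.
Hypothesis h_cont : continuous_paths T h.
Hypothesis mh : forall s, 0 <= s <= T -> measurable_fun setT (h s).
Hypothesis a_gt0 : 0 < a.

Let grid_in n j : 0 <= grid t n j <= T.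
Proof.
by case/andP: tT => t0 tT'; rewrite grid_ge0//= (le_trans (grid_le _ _ t0)).
Qed.

(* Contains the event that h first exceeds a on the grid with a value above 2a. *)
Definition overshoot (n : nat) : set Omega := [set w | 2 * a < h 0 w \/
  exists2 j, (j < 2 ^ n)%N & a < h (grid t n j.+1) w - h (grid t n j) w].

Lemma measurable_overshoot n : measurable (overshoot n).
Proof.
have -> : overshoot n = [set w | 2 * a < h 0 w] `|`
    \bigcup_(j in `I_(2 ^ n)) [set w | a < h (grid t n j.+1) w - h (grid t n j) w].
  by apply/seteqP; split => w /= [?|]; [left|move=> [j]; right; exists j|left|
    move=> [j]; right; exists j].
apply: measurableU; last apply: bigcup_measurable => j _.
- rewrite -[X in measurable X]setTI; apply: measurable_fun_ltr => //.
  by apply: mh; case/andP: tT => t0 /(le_trans t0) ->; rewrite lexx.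
- rewrite -[X in measurable X]setTI; apply: measurable_fun_ltr => //.
  by apply: measurable_funB; exact: mh.
Qed.

Lemma overshoot_not (w : Omega) : h 0 w <= 2 * a ->
  \forall n \near \oo, ~ overshoot n w.
Proof.
move=> h0; have [r r0 hr] := unif_cont_segment (@h_cont w) a_gt0.
case/andP: tT => t0 tT'.
exists (Num.bound (t / r)) => // n /= hn [|]; first by rewrite ltNge h0.
move=> [j jn]; apply/negP; rewrite -leNgt.
apply/ltW/ltr_normlW/hr; rewrite ?in_itv//=.
rewrite ger0_norm ?subr_ge0 ?grid_mono//.
apply: le_lt_trans (grid_step _ _ t0) _.
rewrite ltr_pdivrMr ?exprn_gt0// mulrC -ltr_pdivrMr//.
have := archi_boundP (divr_ge0 t0 (ltW r0)) => /lt_trans; apply.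
rewrite -natrX ltr_nat; apply: leq_ltn_trans hn _; exact: ltn_expl.
Qed.

(** Each path leaves [overshoot n] for good once the mesh is finer than its modulus of continuity at
    [a], so dominated convergence applies to the fixed function [f]. *)
Lemma Rintegral_overshoot (f : Omega -> R) (e : R) : integ f ->
  {ae P, forall w, h 0 w <= 2 * a} -> 0 < e ->
  exists n, \int[P]_(w in overshoot n) f w <= e.
Proof.
move=> hf h0 e0.
have mo := measurable_overshoot.
have cvg0 : {ae P, forall w, [set: Omega] w ->
    (fun n => (f w * \1_(overshoot n) w)%:E) @ \oo --> 0%E}.
  apply: filterS h0 => w h0 _; apply: cvg_near_cst.
  apply: filterS (overshoot_not h0) => n ho /=.
  by rewrite indicE memNset// mulr0.
have dom : {ae P, forall w n, [set: Omega] w ->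
    (`|(f w * \1_(overshoot n) w)%:E| <= `|(f w)%:E|)%E}.
  apply: aeW => w n _; rewrite lee_fin normrM -[leRHS]mulr1 ler_wpM2l//.
  by rewrite indicE; case: (_ \in _); rewrite ?normr1 ?normr0.
have [_ _] := dominated_convergence measurableT
  (fun n => measurable_int _ (integ_mulind (mo n) hf))
  (measurable_cst _) cvg0 (integrable_abse hf) dom.
rewrite integral0 => /fine_cvgP[_] /cvgrPdist_lt /(_ e e0) [n _ /(_ n (leqnn n))] /=.
rewrite sub0r normrN => /ltr_normlW /ltW he; exists n.
by rewrite -[overshoot n]setTI -Rintegral_mulind.
Qed.

End overshoot.

(** * Martingales in continuous time and their traces on dyadic grids *)

Section continuous_time.
Context {R : realType} (d : measure_display) (Omega : measurableType d).
Variable P : probability Omega R.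
Local Notation integ f := (P.-integrable [set: Omega] (EFin \o f)).

Definition event_filtration_on (T : R) (F : R -> set (set Omega)) : Prop :=
  [/\ forall s E, s <= T -> F s E -> measurable E, forall s, F s setT,
      forall s A B, F s A -> F s B -> F s (A `&` B),
      forall s A, F s A -> F s (~` A) &
      forall s t A, s <= t -> F s A -> F t A].

Definition event_martingale_on (T : R) F (M : R -> Omega -> R) : Prop :=
  (forall t, 0 <= t <= T -> integ (M t)) /\
  forall s t E, 0 <= s -> s <= t -> t <= T -> F s E ->
    \int[P]_(w in E) M t w = \int[P]_(w in E) M s w.

Variables (T : R) (F : R -> set (set Omega)).
Hypothesis Ffilt : event_filtration_on T F.

Lemma event_martingale_onD M N :
  event_martingale_on T F M -> event_martingale_on T F N ->
  event_martingale_on T F (fun t w => M t w + N t w).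
Proof.
move=> [iM hM] [iN hN]; case: Ffilt => mF _ _ _ _.
split=> [t tT|s t E s0 st tT FE]; first by apply: integD; [exact: iM|exact: iN].
have mE := mF _ _ (le_trans st tT) FE.
have t' : 0 <= t <= T by rewrite (le_trans s0).
have s' : 0 <= s <= T by rewrite s0 (le_trans st).
rewrite !RintegralD//; try exact: integ_sub (iM _ _); try exact: integ_sub (iN _ _).
by rewrite (hM s t)// (hN s t).
Qed.

Lemma event_martingale_onZ c M : event_martingale_on T F M ->
  event_martingale_on T F (fun t w => c * M t w).
Proof.
move=> [iM hM]; case: Ffilt => mF _ _ _ _.
split=> [t tT|s t E s0 st tT FE]; first by apply: integZ; exact: iM.
have mE := mF _ _ (le_trans st tT) FE.
have t' : 0 <= t <= T by rewrite (le_trans s0).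
have s' : 0 <= s <= T by rewrite s0 (le_trans st).
rewrite !RintegralZl//; try exact: integ_sub (iM _ _).
by rewrite (hM s t).
Qed.

Lemma event_martingale_onB M N :
  event_martingale_on T F M -> event_martingale_on T F N ->
  event_martingale_on T F (fun t w => M t w - N t w).
Proof.
move=> hM /(event_martingale_onZ (-1)) /(event_martingale_onD hM).
by under eq_fun do under eq_fun do rewrite mulN1r.
Qed.

Lemma event_martingale_on_cst f : integ f ->
  event_martingale_on T F (fun=> f).
Proof. by move=> hf; split. Qed.

Lemma event_filtration_grid t n : 0 <= t <= T ->
  event_filtration (fun i => F (grid t n i)).
Proof.
move=> /andP[t0 tT]; case: Ffilt => mF FT FI FC FS; split.
- by move=> i E; apply: mF; exact: le_trans (grid_le _ _ t0) tT.
- by move=> i; exact: FT.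
- by move=> i; exact: FI.
- by move=> i; exact: FC.
- by move=> i A; apply: FS; exact: grid_mono.
Qed.

Lemma event_martingale_grid M t n : 0 <= t <= T -> event_martingale_on T F M ->
  event_martingale P (fun i => F (grid t n i)) (fun i => M (grid t n i)).
Proof.
move=> /andP[t0 tT] [iM hM]; split=> [i|i E FE].
  by apply: iM; rewrite grid_ge0//= (le_trans (grid_le _ _ t0)).
apply: hM => //; first exact: grid_ge0.
  exact: grid_mono.
exact: le_trans (grid_le _ _ t0) tT.
Qed.

End continuous_time.

(** * Square integrable martingales with an almost surely nondecreasing compensator *)

Section compensated_martingale.
Context {R : realType} (d : measure_display) (Omega : measurableType d).
Variable P : probability Omega R.
Local Notation integ f := (P.-integrable [set: Omega] (EFin \o f)).

Variables (T : R) (F : R -> set (set Omega)).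
Hypothesis Ffilt : event_filtration_on T F.
Variables (x : R) (M A : R -> Omega -> R).
Hypothesis M_adapted : adapted T F M.
Hypothesis M_cont : continuous_paths T M.
Hypothesis M_mart : event_martingale_on P T F M.
Hypothesis iM2 : forall t, 0 <= t <= T -> integ (fun w => M t w ^+ 2).
Hypothesis iA : forall t, 0 <= t <= T -> integ (A t).
Hypothesis MA_mart :
  event_martingale_on P T F (fun t w => M t w ^+ 2 - A t w).
Hypothesis M0 : {ae P, forall w, M 0 w = x}.
Hypothesis A0 : {ae P, forall w, A 0 w = 0}.
Hypothesis A_mono : forall s t, 0 <= s -> s <= t -> t <= T ->
  {ae P, forall w, A s w <= A t w}.

Variable t : R.
Hypothesis tT : 0 <= t <= T.

Let t_ge0 : 0 <= t. Proof. by case/andP: tT. Qed.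
Let T_ge0 : 0 <= T. Proof. by case/andP: tT => t0 /(le_trans t0). Qed.
Let zeroT : (0 : R) <= 0 <= T. Proof. by rewrite lexx. Qed.

Let gridT n j : 0 <= grid t n j <= T.
Proof. by rewrite grid_ge0//= (le_trans (grid_le _ _ t_ge0))//; case/andP: tT. Qed.

Let iM s : 0 <= s <= T -> integ (M s).
Proof. by case: M_mart => + _; exact. Qed.

Let Y s w := (M s w - x) ^+ 2.

Let YE s w : Y s w = M s w ^+ 2 + ((- 2 * x) * M s w + x ^+ 2).
Proof. by rewrite /Y; ring. Qed.

Let iY s : 0 <= s <= T -> integ (Y s).
Proof.
move=> sT; rewrite (_ : Y s = fun w => M s w ^+ 2 + ((- 2 * x) * M s w + x ^+ 2)).
  by apply: integD; [exact: iM2|apply: integD; [exact/integZ/iM|exact: integ_cst]].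
by apply/funext => w; exact: YE.
Qed.

Let YA_mart : event_martingale_on P T F (fun s w => Y s w - A s w).
Proof.
have := event_martingale_onD Ffilt MA_mart
  (event_martingale_onD Ffilt (event_martingale_onZ Ffilt (- 2 * x) M_mart)
    (event_martingale_on_cst T F (integ_cst P (x ^+ 2)))).
rewrite (_ : (fun s w => Y s w - A s w) = (fun s w => M s w ^+ 2 - A s w +
  ((- 2 * x) * M s w + x ^+ 2)))//.
by apply/funext => s; apply/funext => w; rewrite YE; ring.
Qed.

Let A_ge0 s : 0 <= s <= T -> {ae P, forall w, 0 <= A s w}.
Proof.
move=> /andP[s0 sT]; apply: filterS2 A0 (A_mono (lexx 0) s0 sT).
by move=> w ->.
Qed.

Let int_start : \int[P]_w (Y 0 w - A 0 w) = 0.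
Proof.
transitivity (\int[P]_(w in [set: Omega]) (0 : R)).
  apply: ae_eq_Rintegral => //.
  - by apply: integB; [exact: iY|exact: iA].
  - exact: integ_cst.
  - by apply: filterS2 M0 A0 => w hM hA; rewrite /Y hM hA subrr expr0n/= subrr.
by rewrite Rintegral_prob// mul0r.
Qed.

Let adapted_dist s c : 0 <= s <= T -> F s [set w | `|M s w - x| <= c].
Proof.
move=> sT; have mB : measurable [set r : R | `|r - x| <= c].
  rewrite -[X in measurable X]setTI; apply: measurable_fun_ler => //.
  by apply: measurableT_comp => //; apply: measurable_funB.
by have := M_adapted sT mB.
Qed.

Let A_le_end n i : {ae P, forall w, A (grid t n i) w <= A (grid t n (2 ^ n)) w}.
Proof.
rewrite grid_last; apply: A_mono; first exact: grid_ge0.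
  exact: grid_le.
by case/andP: tT.
Qed.

Definition stays n c : set Omega :=
  below (fun i w => `|M (grid t n i) w - x|) c (2 ^ n).+1.

(** For continuous paths, the event that [|M - x|] exceeds [c] somewhere on [[0, t]]. The bound
    [(2 ^ n).+1] in [stays] includes the endpoint [t], and the countable union keeps the event
    measurable. *)
Definition leaves (c : R) : set Omega := \bigcup_n ~` stays n c.

Let Fgrid n := event_filtration_grid Ffilt n tT.
Let YAgrid n := event_martingale_grid n tT YA_mart.

Let adapted_grid n c i :
  F (grid t n i) [set w | `|M (grid t n i) w - x| <= c].
Proof. exact: adapted_dist. Qed.

Lemma measurable_stays n c : measurable (stays n c).
Proof. by apply: (measurable_below (Fgrid n)) => i; exact: adapted_dist. Qed.

Lemma measurable_leaves c : measurable (leaves c).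
Proof.
by apply: bigcup_measurable => n _; apply: measurableC; exact: measurable_stays.
Qed.

Lemma stays_nonincreasing c m n : (m <= n)%N -> stays n c `<=` stays m c.
Proof.
move=> /subnK <-; elim: (n - m)%N => // k IH; apply: subset_trans IH.
move=> w hw j jk /=; rewrite grid_refine//; apply: hw.
by rewrite ltnS expnS leq_pmul2l.
Qed.

Lemma kolmogorov_inequality c : 0 <= c ->
  c ^+ 2 * fine (P (leaves c)) <= \int[P]_w A t w.
Proof.
move=> c0; have mC n : measurable (~` stays n c).
  by apply: measurableC; exact: measurable_stays.
have bound n : c ^+ 2 * fine (P (~` stays n c)) <= \int[P]_w A t w.
  have := @maximal_inequality _ _ _ _ _ (Fgrid n) _ _ (adapted_grid n c)
    (fun i => Y (grid t n i)) (fun i => A (grid t n i)) (2 ^ n)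
    (fun i => iY (gridT n i)) (fun i => iA (gridT n i)) (YAgrid n)
    (fun i _ => A_le_end n i) (fun i => aeW _ (fun w => sqr_ge0 _)) (c ^+ 2).
  rewrite grid0 int_start add0r grid_last; apply => i w cw.
  by rewrite /Y -[leRHS]real_normK ?num_real// ler_sqr// ?nnegrE// ltW.
(* The grid bound is uniform in [n], and refining the grid only enlarges the event, so continuity
   from below passes it on to [leaves c]. *)
have cvgP : (P \o (fun n => ~` stays n c)) @ \oo --> P (leaves c).
  apply: nondecreasing_cvg_mu => //; first exact: measurable_leaves.
  move=> m n mn; apply/subsetPset; apply: subsetC; exact: stays_nonincreasing.
have [->|cn0] := eqVneq c 0.
  rewrite expr0n /= mul0r; apply: ae_Rintegral_ge0 => //; first exact: iA.
  exact: A_ge0.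
have c2 : 0 < c ^+ 2 by rewrite exprn_gt0// lt_neqAle eq_sym cn0.
rewrite mulrC -ler_pdivlMr//.
rewrite -lee_fin fineK ?fin_num_measure//; last exact: measurable_leaves.
rewrite -(cvg_lim _ cvgP)//; apply: lime_le.
  by apply/cvg_ex; exists (P (leaves c)).
apply: nearW => n /=; rewrite -[leLHS]fineK ?fin_num_measure//.
by rewrite lee_fin ler_pdivlMr// mulrC.
Qed.

Lemma stays_compensator_bound a b : 0 < a -> 0 < b ->
  b * fine (P ([set w | b <= A t w] `\` leaves a)) <= 4 * a ^+ 2.
Proof.
move=> a0 b0.
pose h s w := `|M s w - x|.
have mA : measurable [set w | b <= A t w].
  rewrite -[X in measurable X]setTI; apply: measurable_fun_ler => //.
  by apply: integ_measurable; exact: iA.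
have mE : measurable ([set w | b <= A t w] `\` leaves a).
  by apply: measurableD => //; exact: measurable_leaves.
have h_cont : continuous_paths T h.
  move=> w; apply/subspace_continuousP => s sT.
  apply: cvg_norm; apply: cvgB; last exact: cvg_cst.
  by move/subspace_continuousP : (@M_cont w); exact.
have mh s : 0 <= s <= T -> measurable_fun setT (h s).
  move=> sT; apply: measurableT_comp => //; apply: measurable_funB => //.
  exact/integ_measurable/iM.
have h0 : {ae P, forall w, h 0 w <= 2 * a}.
  by apply: filterS M0 => w hw; rewrite /h hw subrr normr0; lra.
apply/ler_addgt0Pr => e e0.
have [n hn] := Rintegral_overshoot tT h_cont mh a0 (iY tT) h0 e0.
apply: le_trans (_ : \int[P]_(w in stays n a) A t w <= _); last first.
  (* The dominating martingale is the constant [(2 * a) ^+ 2]: without overshoot the stopped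
     distance to [x] is at most [2 * a]. *)
  have := @stopped_compensator_le _ _ _ _ _ (Fgrid n) _ _ (adapted_grid n a)
    (fun i => Y (grid t n i)) (fun i => A (grid t n i)) (2 ^ n)
    (fun i => iY (gridT n i)) (fun i => iA (gridT n i)) (YAgrid n)
    (fun i _ => A_le_end n i) (fun i => aeW _ (fun w => sqr_ge0 _))
    (fun _ _ => (2 * a) ^+ 2) (2 * a) (overshoot t h a n)
    (event_martingale_cst _ (integ_cst P _)) (fun=> aeW _ (fun=> sqr_ge0 _)).
  rewrite grid0 int_start grid_last Rintegral_prob// probability_setT mulr1.
  rewrite (_ : (2 * a) ^+ 2 = 4 * a ^+ 2); last by ring.
  move=> H; apply: le_trans (H _ _ _ _ _ _ _) _ => //.
  - move=> i; apply: aeW => w hw; rewrite (_ : 4 * a ^+ 2 = (2 * a) ^+ 2); last by ring.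
    by rewrite /Y -real_normK ?num_real// ler_sqr ?nnegrE//; lra.
  - by lra.
  - by move=> i; exact: A_ge0.
  - exact: (measurable_overshoot _ tT mh).
  - move=> [|i] w iN [bi /= ai] h2; first by left; rewrite grid0 in h2.
    right; exists i => //=.
    by have := bi i (ltnSn i); rewrite /h; rewrite /= in h2; lra.
  - by rewrite lerD2l.
apply: le_trans (markov_fine mE (iA tT) _) _; first by move=> w [].
have ms := measurable_stays n a.
rewrite -[X in \int[P]_(_ in X) _]setTI -[X in _ <= \int[P]_(_ in X) _]setTI.
rewrite -!Rintegral_mulind; apply: ae_le_Rintegral => //.
- by apply: integ_mulind => //; exact: iA.
- by apply: integ_mulind => //; exact: iA.
- apply: filterS (A_ge0 tT) => w Aw; apply: ler_wpM2l => //.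
  rewrite !indicE ler_nat; case: (boolP (w \in _ `\` _)) => //.
  rewrite inE => -[_ hw]; rewrite mem_set//.
  by apply: contrapT => sw; apply: hw; exists n.
Qed.

(** While [0 <= M <= 2 * a], the square is dominated by the martingale [2 * a * M], whose mean
    [2 * a * x] is linear in the starting point. Passing above [a] costs [x / a], a large
    compensator without passage costs [2 * a * x / b], and [a = sqrt b] makes the sum
    [3 * x / sqrt b]. *)
Lemma nonneg_compensator_tail b : 0 < b ->
  (forall s, 0 <= s <= T -> {ae P, forall w, 0 <= M s w}) ->
  fine (P [set w | b <= A t w]) <= 3 * x / Num.sqrt b.
Proof.
move=> b0 Mge0; set a := Num.sqrt b.
have a0 : 0 < a by rewrite sqrtr_gt0.
have ab : a ^+ 2 = b by rewrite sqr_sqrtr// ltW.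
have mA : measurable [set w | b <= A t w].
  rewrite -[X in measurable X]setTI; apply: measurable_fun_ler => //.
  by apply: integ_measurable; exact: iA.
have P1 (E : set Omega) : measurable E -> fine (P E) <= 1.
  move=> mE; rewrite -lee_fin fineK ?fin_num_measure//.
  exact: probability_le1.
(* If [x > 2 * a] the claimed bound exceeds 1; otherwise the starting value is itself no
   overshoot. *)
have [ax|xa] := ltP (2 * a) x.
  apply: le_trans (P1 _ mA) _; rewrite ler_pdivlMr// mul1r; lra.
have x0 : \int[P]_w M 0 w = x.
  transitivity (\int[P]_(w in [set: Omega]) x).
    apply: ae_eq_Rintegral => //; first exact: iM.
    exact: integ_cst.
  by rewrite Rintegral_prob// probability_setT /= mulr1.
have xge0 : 0 <= x.
  by rewrite -x0; apply: ae_Rintegral_ge0 => //; [exact: iM|exact: Mge0].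
have adM s c : 0 <= s <= T -> F s [set w | M s w <= c].
  move=> sT; have mB : measurable [set r : R | r <= c].
    by rewrite -[X in measurable X]setTI; apply: measurable_fun_ler.
  by have := M_adapted sT mB.
have adMgrid n c i : F (grid t n i) [set w | M (grid t n i) w <= c].
  exact: adM.
have mM s : 0 <= s <= T -> measurable_fun setT (M s).
  by move=> sT; exact/integ_measurable/iM.
have h0 : {ae P, forall w, M 0 w <= 2 * a} by apply: filterS M0 => w ->.
have M2A_mart n := event_martingale_grid n tT MA_mart.
have start : \int[P]_w (M 0 w ^+ 2 - A 0 w) = x ^+ 2.
  transitivity (\int[P]_(w in [set: Omega]) (x ^+ 2)).
    apply: ae_eq_Rintegral => //.
    - by apply: integB; [exact: iM2|exact: iA].
    - exact: integ_cst.
    - by apply: filterS2 M0 A0 => w -> ->; rewrite subr0.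
  by rewrite Rintegral_prob// probability_setT /= mulr1.
suff main : forall e, 0 < e ->
    fine (P [set w | b <= A t w]) <= x / a + (2 * a * x + e) / b.
  have -> : 3 * x / a = x / a + 2 * a * x / b.
    by rewrite -ab; field; rewrite gt_eqF.
  apply/ler_addgt0Pr => e e0; apply: le_trans (main (e * b) _) _.
    exact: mulr_gt0.
  by rewrite mulrDl mulfK ?gt_eqF// addrA.
move=> e e0.
have [n hn] := Rintegral_overshoot tT M_cont mM a0 (iM2 tT) h0 e0.
pose U := below (fun i w => M (grid t n i) w) a (2 ^ n).+1.
have mU : measurable U by exact: (measurable_below (Fgrid n) (adMgrid n a)).
have step1 : fine (P (~` U)) <= x / a.
  rewrite ler_pdivlMr// mulrC.
  have Mgrid := event_martingale_grid n tT M_mart.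
  rewrite (prob_exceed P (Fgrid n) (adMgrid n a)) mulr_sumr.
  have := optional_stopping (Fgrid n) (adMgrid n a) (2 ^ n) Mgrid.
  rewrite grid0 x0 => ->; rewrite -[leLHS]addr0; apply: lerD; last first.
    by apply: ae_Rintegral_ge0 => //; [exact: iM|exact: Mge0].
  apply: ler_sum => j _; apply: markov_fine.
  - exact: (measurable_exceed (Fgrid n) (adMgrid n a)).
  - exact: iM.
  - by move=> w [_ /= /ltW].
have step2 : \int[P]_(w in U) A t w <= 2 * a * x + e.
  have := @stopped_compensator_le _ _ _ _ _ (Fgrid n) _ _ (adMgrid n a)
    (fun i w => M (grid t n i) w ^+ 2) (fun i => A (grid t n i)) (2 ^ n)
    (fun i => iM2 (gridT n i)) (fun i => iA (gridT n i)) (M2A_mart n)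
    (fun i _ => A_le_end n i) (fun i => aeW _ (fun w => sqr_ge0 _))
    (fun i w => (2 * a) * M (grid t n i) w) (2 * a) (overshoot t M a n)
    (event_martingaleZ (2 * a) (Fgrid n) (event_martingale_grid n tT M_mart)).
  rewrite grid0 grid_last RintegralZl//; last exact: iM.
  rewrite x0 => H; apply: le_trans (H _ _ _ _ _ _ _ _) _ => //.
  - move=> i; apply: filterS (Mge0 _ (gridT n i)) => w Mw.
    by rewrite mulr_ge0// mulr_ge0// ltW.
  - move=> i; apply: filterS (Mge0 _ (gridT n i)) => w Mw hw.
    by rewrite expr2 ler_wpM2r.
  - by lra.
  - by move=> i; exact: A_ge0.
  - by rewrite start sqr_ge0.
  - exact: (measurable_overshoot _ tT mM).
  - move=> [|i] w iN [bi /= ai] h2; first by left; rewrite grid0 in h2.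
    right; exists i => //=.
    by have := bi i (ltnSn i); lra.
  - by rewrite lerD2l.
have mAU : measurable ([set w | b <= A t w] `&` U) by exact: measurableI.
have step3 : fine (P ([set w | b <= A t w] `&` U)) <= (2 * a * x + e) / b.
  rewrite ler_pdivlMr// mulrC.
  apply: le_trans (markov_fine mAU (iA tT) _) _; first by move=> w [].
  apply: le_trans step2; rewrite setIC -Rintegral_mulind.
  apply: ae_le_Rintegral => //.
  - by apply: integ_mulind => //; exact: iA.
  - exact: iA.
  - apply: filterS (A_ge0 tT) => w Aw; rewrite -[leRHS]mulr1; apply: ler_wpM2l => //.
have mUC : measurable (~` U) by exact: measurableC.
apply: le_trans (lerD step1 step3); apply: le_trans (fine_probU P mUC mAU).
apply: fine_le_prob => //; first exact: measurableU.
by move=> w hw; have [Uw|Uw] := pselect (U w); [right|left].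
Qed.

End compensated_martingale.

(** * Mass and brackets along ordered paths *)

Section pathwise.
Context {R : realType} (d : measure_display) (Omega : measurableType d).
Local Notation mu := (@lebesgue_measure R).

(** Monotonicity is taken from the outer measure, so the sets that define [mass] call for no
    measurability proof. *)
Lemma lebesgue_measure_le (A B : set R) : A `<=` B -> (mu A <= mu B)%E.
Proof. by move=> AB; apply: (le_mu_ext (wlength idfun)). Qed.

Lemma inve_anti (x y : \bar R) : (0 <= x -> x <= y -> y^-1 <= x^-1)%E.
Proof.
move: x y => [x| |] [y| |] //= x0 xy; rewrite ?invey ?inve_ge0//.
rewrite !inver; have [_|x_neq0] := eqVneq x 0; first by rewrite leey.
have xgt0 : 0 < x by rewrite lt_neqAle eq_sym x_neq0.
rewrite lee_fin in xy; rewrite gt_eqF ?(lt_le_trans xgt0)//.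
by rewrite lee_fin lef_pV2// posrE (lt_le_trans xgt0).
Qed.

Lemma measurable_nonincreasing (D : set R) (f : R -> \bar R) : measurable D ->
  {homo f : x y / x <= y >-> (y <= x)%E} -> measurable_fun D f.
Proof.
move=> mD fh; apply: (measurability _ (ErealGenCInfty.measurableE R)) => //.
move=> _ [_ [x ->] <-]; apply: measurableI => //.
apply: is_interval_measurable => r s /=; rewrite !in_itv /= !andbT.
move=> xr xs z /andP[rz zs]; rewrite in_itv/= andbT.
exact: le_trans xs (fh _ _ zs).
Qed.

Variables (T : R) (X : R -> R -> Omega -> R).
Implicit Types (u v t s : R) (w : Omega).

Definition ordered_paths w : Prop := forall u v t, u \in `]0, 1[ ->
  v \in `]0, 1[ -> u <= v -> t \in `[0, T] -> X u t w <= X v t w.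

Lemma mass_le u s t w : s <= t -> (mass X u s w <= mass X u t w)%E.
Proof.
move=> st; apply: lebesgue_measure_le => v [v01 [r [rs e]]]; split=> //.
exists r; split=> //; move: rs; rewrite !in_itv/= => /andP[-> rs].
exact: le_trans st.
Qed.

Lemma mass_ge0 u t w : (0 <= mass X u t w)%E.
Proof. exact: measure_ge0. Qed.

Lemma mass_fin_num u t w : mass X u t w \is a fin_num.
Proof.
rewrite ge0_fin_numE ?mass_ge0//; apply: (@le_lt_trans _ _ (mu `]0, 1[)).
  by apply: lebesgue_measure_le => v [].
by rewrite lebesgue_measure_itv/= lte_fin ltr01 -EFinD ltry.
Qed.

Definition rate u v w s : \bar R :=
  ((\1_[set r : R | (meeting_time T X u v w <= r%:E)%E] s)%:E *
   (mass X u s w)^-1)%E.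

(** The right-hand side of (C4), kept in the extended reals: it is known to be finite only almost
    surely, where it equals a bracket. *)
Definition clock u v t w : \bar R :=
  (\int[mu]_(s in `[0%R, t]) rate u v w s)%E.

Lemma rate_ge0 u v w s : (0 <= rate u v w s)%E.
Proof. by rewrite mule_ge0 ?inve_ge0 ?mass_ge0// lee_fin. Qed.

Lemma rate_le u v w s : (rate u v w s <= (mass X u s w)^-1)%E.
Proof.
rewrite /rate indicE; case: (_ \in _); rewrite ?mul1e// mul0e.
by rewrite inve_ge0 mass_ge0.
Qed.

Lemma measurable_rate (D : set R) u v w :
  measurable D -> measurable_fun D (rate u v w).
Proof.
move=> mD; apply: emeasurable_funM.
  apply/measurable_EFinP; apply: measurable_indic.
  apply: is_interval_measurable => r s /= mr ms z /andP[rz zs] /=.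
  by apply: le_trans mr _; rewrite lee_fin.
apply: measurable_nonincreasing => // r s rs.
by apply: inve_anti; [exact: mass_ge0|exact: mass_le].
Qed.

Lemma rate_diag u w s : 0 < T -> s \in `[0, T] ->
  rate u u w s = (mass X u s w)^-1%E.
Proof.
move=> T0; rewrite in_itv/= => /andP[s0 sT].
rewrite /rate indicE mem_set ?mul1e//= /meeting_time.
rewrite ge_min; apply/orP; left; apply: (@le_trans _ _ 0%E); last by rewrite lee_fin.
by apply: ereal_inf_lbound; exists 0 => //=; split=> //; rewrite in_itv/= lexx ltW.
Qed.

Lemma clock_ge0 u v t w : (0 <= clock u v t w)%E.
Proof. by apply: integral_ge0 => s _; exact: rate_ge0. Qed.

Lemma clock_split u v s t w : 0 <= s -> s <= t ->
  clock u v t w = (clock u v s w + \int[mu]_(r in `]s, t]) rate u v w r)%E.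
Proof.
move=> s0 st; rewrite /clock (@itv_bndbnd_setU _ _ _ (BRight s))//=.
rewrite ge0_integral_setU//.
- by apply: measurable_rate; exact: measurableU.
- by move=> *; exact: rate_ge0.
- apply/disj_set2P; apply/seteqP; split=> r //= -[].
  by rewrite !in_itv/= => /andP[_ rs] /andP[]; rewrite ltNge rs.
Qed.

(** The rate of the pair [(u, v)] is that of [(u, u)] switched off before the meeting, hence smaller
    on every interval. Finite values enter through equations, so that no difference of infinities is
    formed. *)
Lemma clock_increment u v s t w (a b a' b' : R) : 0 < T -> 0 <= s -> s <= t ->
  t <= T -> a%:E = clock u u s w -> b%:E = clock u u t w ->
  a'%:E = clock u v s w -> b'%:E = clock u v t w -> a - a' <= b - b'.
Proof.
move=> T0 s0 st tT ea eb ea' eb'.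
have le : (\int[mu]_(r in `]s, t]) rate u v w r <=
           \int[mu]_(r in `]s, t]) rate u u w r)%E.
  apply: ge0_le_integral => //.
  - by move=> *; exact: rate_ge0.
  - exact: measurable_rate.
  - exact: measurable_rate.
  - move=> r /=; rewrite in_itv/= => /andP[r0 rt]; rewrite [leRHS]rate_diag ?rate_le//.
    by rewrite in_itv/= (le_trans s0 (ltW r0)) (le_trans rt).
rewrite (clock_split _ _ _ s0 st) -ea in eb.
rewrite (clock_split _ _ _ s0 st) -ea' in eb'.
move: eb eb' le.
set I := (\int[mu]_(r in _) rate u u w r)%E.
set J := (\int[mu]_(r in _) rate u v w r)%E.
move: I J => [i| |] [j| |] //.
by rewrite -!EFinD => -[->] [->]; rewrite lee_fin; lra.
Qed.

Lemma clock_ge u t w (m : R) : 0 < T -> 0 <= t -> t <= T -> 0 < m ->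
  (mass X u t w <= m%:E)%E -> ((t / m)%:E <= clock u u t w)%E.
Proof.
move=> T0 t0 tT m0 hm.
apply: (@le_trans _ _ (\int[mu]_(s in `[0%R, t]) (m^-1)%:E)%E).
  rewrite integral_cst//= lebesgue_measure_itv/= lte_fin.
  have [tgt|] := ltP 0 t; first by rewrite sube0 -EFinM mulrC.
  by move=> tle; rewrite mule0 lee_fin (_ : t = 0) ?mul0r//; lra.
apply: ge0_le_integral => //.
- by move=> *; rewrite lee_fin invr_ge0 ltW.
- exact: measurable_rate.
- move=> s /=; rewrite in_itv/= => /andP[s0 st]; rewrite rate_diag//; last first.
    by rewrite in_itv/= s0 (le_trans st).
  have -> : (m^-1)%:E = (m%:E)^-1%E by rewrite inver gt_eqF.
  apply: inve_anti; first exact: mass_ge0.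
  by apply: le_trans hm; exact: mass_le.
Qed.

(** At a meeting of [u] and [v] the ordering squeezes every particle between them onto the same
    point, and [mass] remembers all meetings up to [s]. *)
Lemma mass_after_meeting u v s r w : ordered_paths w ->
  u \in `]0, 1[ -> v \in `]0, 1[ -> r \in `[0, T] -> r <= s ->
  X u r w = X v r w -> (`|v - u|%:E <= mass X u s w)%E.
Proof.
move=> ow u01 v01 rT rs e; have e' := esym e.
have between p q : p \in `]0, 1[ -> q \in `]0, 1[ -> p <= q ->
    X p r w = X u r w -> X q r w = X u r w ->
    ((q - p)%:E <= mass X u s w)%E.
  move=> p01 q01 pq ep eq.
  apply: (@le_trans _ _ (mu `[p, q])).
    rewrite lebesgue_measure_itv/= lte_fin; case: ltP => qp; first by rewrite -EFinB.
    by rewrite lee_fin; lra.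
  apply: lebesgue_measure_le => z /=; rewrite in_itv/= => /andP[pz zq].
  have z01 : z \in `]0, 1[.
    move: p01 q01; rewrite !in_itv/= => /andP[p0 p1] /andP[q0 q1].
    by rewrite (lt_le_trans p0)//= (le_lt_trans zq).
  split=> //; exists r; split.
    by move: rT; rewrite !in_itv/= rs andbT => /andP[].
  apply/eqP; rewrite eq_le -{1}ep ow//= -eq; exact: ow.
have [uv|vu] := leP u v.
  by rewrite ger0_norm ?subr_ge0//; exact: between.
by rewrite distrC gtr0_norm ?subr_gt0//; apply: between => //; exact: ltW.
Qed.

Lemma clock_meeting u v t w : 0 < T -> 0 <= t -> t <= T -> ordered_paths w ->
  u \in `]0, 1[ -> v \in `]0, 1[ -> u != v ->
  (clock u v t w <= (t / `|v - u|)%:E)%E.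
Proof.
move=> T0 t0 tT ow u01 v01 uv.
have d0 : 0 < `|v - u| by rewrite normr_gt0 subr_eq0 eq_sym.
apply: (@le_trans _ _ (\int[mu]_(s in `[0%R, t]) (`|v - u|^-1)%:E)%E); last first.
  rewrite integral_cst//= lebesgue_measure_itv/= lte_fin.
  case: ltP => tgt; first by rewrite sube0 -EFinM mulrC.
  by rewrite mule0 lee_fin divr_ge0.
apply: ae_ge0_le_integral => //.
- by move=> *; exact: rate_ge0.
- exact: measurable_rate.
(* only the meeting time itself has to be excluded *)
have : mu.-negligible [set fine (meeting_time T X u v w)].
  exists [set fine (meeting_time T X u v w)]; split => //.
  exact: lebesgue_measure_set1.
apply: negligibleS => s /= /not_implyP[]; rewrite in_itv/= => /andP[s0 st].
move=> hs; apply: contrapT => smt; apply: hs.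
rewrite /rate indicE; case: (boolP (s \in _)) => [|_]; last first.
  by rewrite mul0e lee_fin invr_ge0 ltW.
rewrite inE mul1e /= => mts.
have mt_lt : (meeting_time T X u v w < s%:E)%E.
  rewrite lt_neqAle mts andbT; apply/eqP => e; apply: smt.
  by rewrite e.
(* The cap at [T] cannot be strictly below [s], so the infimum of the true meeting times is; a
   meeting before [s] then exists, whether or not the infimum is attained. *)
have {mt_lt} : (ereal_inf [set r%:E | r in [set r : R | r \in `[0%R, T] /\
    X u r w = X v r w]] < s%:E)%E.
  move: mt_lt; rewrite /meeting_time gt_min => /orP[//|].
  by rewrite lte_fin ltNge (le_trans st).
move=> /ereal_inf_lt [_ [r [rT e] <-]]; rewrite lte_fin => rs.
have -> : (`|v - u|^-1)%:E = (`|v - u|%:E)^-1%E by rewrite inver gt_eqF.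
apply: inve_anti; first by rewrite lee_fin.
exact: (mass_after_meeting ow u01 v01 rT (ltW rs) e).
Qed.

(** A particle from outside [[u - r, u + r]] that meets [u] would, by the ordering, force [u - r] or
    [u + r] onto the same point. *)
Lemma mass_no_meeting u t w (r : R) : ordered_paths w -> t <= T ->
  0 < r -> u \in `]0, 1[ -> u - r \in `]0, 1[ -> u + r \in `]0, 1[ ->
  (forall v, (v = u - r \/ v = u + r) -> forall s, s \in `[0, t] ->
     X u s w <> X v s w) ->
  (mass X u t w <= (2 * r)%:E)%E.
Proof.
move=> ow tT r0 u01 l01 r01 nomeet.
apply: (@le_trans _ _ (mu `[u - r, u + r])); last first.
  rewrite lebesgue_measure_itv/= lte_fin; case: ltP => _.
    by rewrite -EFinB lee_fin; lra.
  by rewrite lee_fin; lra.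
apply: lebesgue_measure_le => v [v01 [s [st e]]] /=; rewrite in_itv/=.
have sT : s \in `[0, T].
  by move: st; rewrite !in_itv/= => /andP[-> /le_trans]; exact.
apply/andP; split; rewrite leNgt; apply/negP => hv.
- apply: (nomeet (u - r) (or_introl erefl) s st); apply/eqP; rewrite eq_le.
  apply/andP; split; last by apply: ow => //; lra.
  by rewrite e; apply: ow => //; exact: ltW.
- apply: (nomeet (u + r) (or_intror erefl) s st); apply/eqP; rewrite eq_le.
  apply/andP; split; first by apply: ow => //; lra.
  by rewrite e; apply: ow => //; exact: ltW.
Qed.

End pathwise.

(** * Natural filtration and ordering of the flow *)

Section ordering.
Context {R : realType} (d : measure_display) (Omega : measurableType d).
Variables (P : probability Omega R) (T : R) (X : R -> R -> Omega -> R).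
Hypothesis T_gt0 : 0 < T.
Hypothesis X_D : forall w : Omega, in_D01C T (fun u t => X u t w).
Hypothesis X_C3 : C3 P T X.

Lemma right_dist (w : Omega) (u t e : R) : u \in `]0, 1[ -> t \in `[0, T] ->
  0 < e -> exists2 r, 0 < r &
  forall v, u < v -> v < u + r -> `|X u t w - X v t w| < e.
Proof.
move=> u01 tT e0; have [_ hu _] := X_D w u01.
pose S := [set f : R -> R | forall s, s \in `[0, T] -> `|X u s w - f s| < e].
have : ((X v)^~ w @[v --> u^'+]) S.
  apply: hu; apply/uniform_nbhs.
  exists [set xy : R * R | ball xy.1 e xy.2]; split.
    exact: entourage_ball (PosNum e0).
  by move=> f /= hf s sT; exact: hf.
move=> [r /= r0 hr]; exists r => // v uv vr; apply: (hr v) => //=.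
by rewrite ltr_norml; apply/andP; split; lra.
Qed.

Lemma ae_countable (I : countType) (S : I -> Omega -> Prop) :
  (forall i, {ae P, forall w, S i w}) -> {ae P, forall w, forall i, S i w}.
Proof.
move=> hS.
have : {ae P, forall w, forall n, if unpickle n is Some i then S i w else True}.
  apply: ae_foralln => n; case: unpickle => [i|]; first exact: hS.
  exact: aeW.
by apply: filterS => w H i; have := H (pickle i); rewrite pickleK.
Qed.

(** (C3) has an exceptional set for each [(u, v, t)]. Rational triples leave one null set,
    continuity in time reaches every [t], and right continuity in space reaches every pair: a
    rational [p] between [u] and [v] and a rational [q] just above [v] keep the order. *)
Lemma ae_ordered : {ae P, forall w, ordered_paths T X w}.
Proof.
pose S (i : rat * rat * rat) (w : Omega) :=
  (ratr i.1.1 : R) \in `]0, 1[ -> (ratr i.1.2 : R) \in `]0, 1[ ->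
  ratr i.1.1 < ratr i.1.2 :> R -> ratr i.2 \in `[0, T] ->
  X (ratr i.1.1) (ratr i.2) w <= X (ratr i.1.2) (ratr i.2) w.
have : {ae P, forall w, forall i, S i w}.
  apply: ae_countable => -[[p q] s]; rewrite /S /=.
  have [p01|] := boolP ((ratr p : R) \in `]0, 1[); last by move=> _; exact: aeW.
  have [q01|] := boolP ((ratr q : R) \in `]0, 1[); last by move=> _; exact: aeW.
  have [pq|] := ltP (ratr p : R) (ratr q); last by move=> _; exact: aeW.
  have [sT|] := boolP (ratr s \in `[0, T]); last by move=> _; exact: aeW.
  by apply: filterS (X_C3 p01 q01 pq sT) => w H _ _ _ _.
apply: filterS => w Sw.
have rational_u (p q : rat) t : (ratr p : R) \in `]0, 1[ -> (ratr q : R) \in `]0, 1[ ->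
    ratr p < ratr q :> R -> t \in `[0, T] ->
    X (ratr p) t w <= X (ratr q) t w.
  move=> p01 q01 pq tT; rewrite leNgt; apply/negP => lt.
  pose e := (X (ratr p) t w - X (ratr q) t w) / 2.
  have e0 : 0 < e by rewrite divr_gt0// subr_gt0.
  have [cp _ _] := X_D w p01; have [cq _ _] := X_D w q01.
  have [r r0 hr] := within_dist cp tT e0.
  have [r' r'0 hr'] := within_dist cq tT e0.
  pose m := Num.min r r'.
  have m0 : 0 < m by rewrite lt_min r0.
  have [s sT ts] : exists2 s : rat, ratr s \in `[0, T] & `|t - ratr s| < m.
    move: tT; rewrite in_itv/= => /andP[t0 tT].
    have [tltT|Tt] := ltP t T.
      have /rat_in_itvoo[s] : t < Num.min (t + m) T by rewrite lt_min tltT andbT; lra.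
      rewrite in_itv/= lt_min => /and3P[ts sm sT].
      exists s; first by rewrite in_itv/=; apply/andP; split; lra.
      by rewrite ltr0_norm; lra.
    have /rat_in_itvoo[s] : Num.max (t - m) 0 < t by rewrite gt_max (lt_le_trans T_gt0 Tt) andbT; lra.
    rewrite in_itv/= gt_max => /andP[/andP[sm s0] st].
    exists s; first by rewrite in_itv/=; apply/andP; split; lra.
    by rewrite gtr0_norm; lra.
  have mr : m <= r by rewrite ge_min lexx.
  have mr' : m <= r' by rewrite ge_min lexx orbT.
  have := hr _ sT (lt_le_trans ts mr); have := hr' _ sT (lt_le_trans ts mr').
  have := Sw (p, q, s) p01 q01 pq sT.
  by rewrite /= !ltr_norml /e => ? /andP[? ?] /andP[? ?]; lra.
move=> u v t u01 v01; rewrite le_eqVlt => /predU1P[->//|uv] tT.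
rewrite leNgt; apply/negP => lt.
pose e := (X u t w - X v t w) / 2.
have e0 : 0 < e by rewrite divr_gt0// subr_gt0.
have [r r0 hr] := right_dist w u01 tT e0.
have [r' r'0 hr'] := right_dist w v01 tT e0.
have v1 : v < 1 by move: v01; rewrite in_itv/= => /andP[].
have u_gt0 : 0 < u by move: u01; rewrite in_itv/= => /andP[].
have /rat_in_itvoo[p] : u < Num.min (u + r) v by rewrite lt_min uv andbT; lra.
rewrite in_itv/= lt_min => /and3P[up pr pv].
have /rat_in_itvoo[q] : v < Num.min (v + r') 1 by rewrite lt_min v1 andbT; lra.
rewrite in_itv/= lt_min => /and3P[vq qr q1].
have := hr _ up pr; have := hr' _ vq qr.
have := rational_u p q t _ _ (lt_trans pv vq) tT.
rewrite !in_itv/= (lt_trans u_gt0 up) (lt_trans pv v1).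
rewrite (lt_trans u_gt0 (lt_trans uv vq)) q1 => /(_ isT isT).
by rewrite !ltr_norml /e => ? /andP[? ?] /andP[? ?]; lra.
Qed.

End ordering.

Section filtration.
Context {R : realType} (d : measure_display) (Omega : measurableType d).
Variables (P : probability Omega R) (T : R) (X : R -> R -> Omega -> R).
Local Notation integ f := (P.-integrable [set: Omega] (EFin \o f)).
Local Notation F := (natural_filtration X).
Hypothesis X_C1 : C1 P T X.

Lemma integ_X u t : u \in `]0, 1[ -> 0 <= t <= T -> integ (X u t).
Proof.
by move=> u01 tT; have [[_ iX _] _ _] := X_C1 u01; apply: iX; rewrite in_itv.
Qed.

Lemma natural_event_filtration : event_filtration_on T F.
Proof.
have sigma s : sigma_algebra setT (F s) by exact: smallest_sigma_algebra.
have C s A : F s A -> F s (~` A).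
  by case: (sigma s) => _ hC _ /hC; rewrite setTD.
split => //.
- move=> s E sT; apply: smallest_sub; first exact: sigma_algebra_measurable.
  move=> _ [u [r [B [u01 rs mB ->]]]]; rewrite -[X in measurable X]setTI.
  apply: integ_measurable => //; apply: integ_X => //.
  by move: rs; rewrite in_itv/= => /andP[-> /le_trans]; exact.
- by move=> s; have [/C + _ _] := sigma s; rewrite setC0.
- move=> s A B FA FB; rewrite -[A `&` B]setCK setCI; apply: (C s).
  have [F0 _ U] := sigma s.
  rewrite -bigcup2E; apply: U => -[|[|n]] /=; [exact: C|exact: C|by []].
- move=> s t A st; apply: (smallest_sub (sigma t)) => E [u [r [B [u01 rs mB ->]]]].
  apply: sub_sigma_algebra; exists u, r, B; split => //.
  by move: rs; rewrite !in_itv/= => /andP[-> /le_trans]; exact.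
Qed.

Lemma event_martingale_X u : u \in `]0, 1[ -> event_martingale_on P T F (X u).
Proof.
move=> u01; have [[_ iX mX] _ _] := X_C1 u01.
split=> [t tT|s t E s0 st tT FE]; first exact: integ_X.
by have [_ _ H] := mX s t s0 st tT; rewrite /Rintegral -(H E FE).
Qed.

Lemma integ_XX u v t : u \in `]0, 1[ -> v \in `]0, 1[ -> 0 <= t <= T ->
  integ (fun w => X u t w * X v t w).
Proof.
move=> u01 v01 tT.
have [_ _ /(_ t)] := X_C1 u01; rewrite in_itv/= => /(_ tT) iu.
have [_ _ /(_ t)] := X_C1 v01; rewrite in_itv/= => /(_ tT) iv.
apply: (le_integrable measurableT _ _ (integD iu iv)).
  apply/measurable_EFinP; apply: measurable_funM; exact/integ_measurable/integ_X.
move=> w _ /=; rewrite lee_fin [leRHS]ger0_norm ?addr_ge0 ?sqr_ge0//.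
rewrite -(real_normK (num_real (X u t w))) -(real_normK (num_real (X v t w))).
rewrite normrM; have := sqr_ge0 (`|X u t w| - `|X v t w|).
by have := sqr_ge0 (`|X u t w|); have := sqr_ge0 (`|X v t w|); nra.
Qed.

(** Passing from the augmentation back to the natural filtration only discards test events, so the
    integral identities survive. *)
Lemma bracket_event_martingale u v A : is_bracket P T F (X u) (X v) A ->
  event_martingale_on P T F (fun t w => X u t w * X v t w - A t w).
Proof.
move=> [_ _ _ _ [_ iM mM]]; split=> [t tT|s t E s0 st tT FE].
  by apply: iM; rewrite in_itv.
have [_ _ H] := mM s t s0 st tT; rewrite /Rintegral -(H E)//.
by apply: sub_sigma_algebra; left.
Qed.

Lemma integ_bracket u v A t : u \in `]0, 1[ -> v \in `]0, 1[ ->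
  is_bracket P T F (X u) (X v) A -> 0 <= t <= T -> integ (A t).
Proof.
move=> u01 v01 hA tT; have [iM _] := bracket_event_martingale hA.
have := integB (integ_XX u01 v01 tT) (iM t tT).
by under eq_fun do rewrite opprB addrC subrK.
Qed.

End filtration.

(** * Series and the Borel-Cantelli lemma *)

Section tails.
Context {R : realType} (d : measure_display) (Omega : measurableType d).
Variable P : probability Omega R.
Local Notation integ f := (P.-integrable [set: Omega] (EFin \o f)).

(** Raising the truncation level of [f] from [2 ^+ n.+1 * b] to its double adds at most the new
    level times the probability that [f] reaches the old one. This is the left-hand side of the tail
    hypothesis, and the increments are dominated by a geometric series. *)
Lemma Rintegral_le_tails (f : Omega -> R) (b k q : R) : integ f -> 0 < b ->
  0 <= k -> 0 <= q < 1 ->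
  (forall n, 2 * (2 ^+ n.+1 * b) * fine (P [set w | 2 ^+ n.+1 * b <= f w]) <=
     k * q ^+ n) ->
  \int[P]_w f w <= 2 * b + k / (1 - q).
Proof.
move=> hf b0 k0 /andP[q0 q1] tail.
pose c n : R := 2 ^+ n.+1 * b.
have c_gt0 n : 0 < c n by rewrite /c mulr_gt0 ?exprn_gt0.
have cS n : c n.+1 = 2 * c n by rewrite /c exprS mulrA.
have mf : measurable_fun setT f by exact: (integ_measurable hf).
have mlt n : measurable [set w | f w < c n].
  by rewrite -[X in measurable X]setTI; apply: measurable_fun_ltr => //.
have mge n : measurable [set w | c n <= f w].
  by rewrite -[X in measurable X]setTI; apply: measurable_fun_ler.
pose I n := \int[P]_w (f w * \1_[set w | f w < c n] w).
have I0 : I 0%N <= 2 * b.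
  apply: le_trans (_ : \int[P]_(w in [set: Omega]) (2 * b) <= _).
    apply: le_Rintegral => //; first exact: (integ_mulind (mlt 0%N) hf).
      exact: (integ_cst P (2 * b)).
    move=> w _; rewrite indicE; have [lt|ge] := ltP (f w) (c 0%N).
      by rewrite mem_set// mulr1 ltW.
    by rewrite memNset ?mulr0 ?mulr_ge0 ?ltW//= ltNge ge.
  by rewrite Rintegral_prob// probability_setT /= mulr1.
have IS n : I n.+1 <= I n + k * q ^+ n.
  apply: le_trans (_ : I n + 2 * c n * \int[P]_w \1_[set w | c n <= f w] w <= _).
    have i1 := integ_mulind (mlt n) hf.
    have i2 : integ (fun w => 2 * c n * \1_[set w | c n <= f w] w).
      by apply: integZ; exact: integ_ind.
    rewrite /I -RintegralZl//; last exact: integ_ind.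
    rewrite -RintegralD//; apply: le_Rintegral => //.
    - exact: (integ_mulind (mlt n.+1) hf).
    - exact: (integD i1 i2).
    move=> w _; rewrite !indicE.
    have [lt|ge] := ltP (f w) (c n).
      rewrite (mem_set (A := [set w | f w < c n]))//.
      rewrite (mem_set (A := [set w | f w < c n.+1])) /=; last first.
        by rewrite cS; have := c_gt0 n; lra.
      by rewrite memNset ?mulr0 ?addr0//= leNgt lt.
    rewrite (memNset (A := [set w | f w < c n])) /=; last by rewrite ltNge ge.
    rewrite mulr0 add0r (mem_set (A := [set w | c n <= f w]))// mulr1.
    have [lt2|ge2] := ltP (f w) (c n.+1).
      by rewrite mem_set// mulr1 -cS ltW.
    by rewrite memNset ?mulr0 ?mulr_ge0 ?ltW//= ltNge ge2.
  by rewrite lerD2l Rintegral_ind// setIT; exact: tail.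
have In n : I n <= 2 * b + k / (1 - q).
  have q10 : 0 < 1 - q by rewrite subr_gt0.
  apply: le_trans (_ : 2 * b + k * ((1 - q ^+ n) / (1 - q)) <= _); last first.
    rewrite lerD2l; apply: ler_wpM2l => //; rewrite -[leRHS]mul1r.
    apply: ler_wpM2r; first by rewrite invr_ge0 ltW.
    by rewrite gerBl exprn_ge0.
  elim: n => [|n IH]; first by rewrite expr0 subrr mul0r mulr0 addr0.
  apply: le_trans (IS n) _; apply: le_trans (lerD IH (lexx _)) _.
  rewrite -addrA lerD2l -mulrDr; apply: ler_wpM2l => //.
  by rewrite le_eqVlt; apply/orP; left; apply/eqP; rewrite exprS; field; rewrite gt_eqF.
have cvgI : I n @[n --> \oo] --> \int[P]_w f w.
  have cvgf : {ae P, forall w, [set: Omega] w ->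
      (fun n => (f w * \1_[set w | f w < c n] w)%:E) @ \oo --> (f w)%:E}.
    apply: aeW => w _; apply: cvg_near_cst.
    exists (Num.bound (`|f w| / b)) => // n /= hn.
    rewrite indicE mem_set ?mulr1//= /c.
    rewrite (le_lt_trans (ler_norm _))// -ltr_pdivrMr//.
    have := archi_boundP (divr_ge0 (normr_ge0 (f w)) (ltW b0)) => /lt_trans; apply.
    rewrite -natrX ltr_nat; apply: leq_ltn_trans hn _.
    by rewrite (ltn_trans (ltnSn n))// ltn_expl.
  have dom : {ae P, forall w n, [set: Omega] w ->
      (`|(f w * \1_[set w | f w < c n] w)%:E| <= `|(f w)%:E|)%E}.
    apply: aeW => w n _; rewrite lee_fin normrM -[leRHS]mulr1 ler_wpM2l//.
    by rewrite indicE; case: (_ \in _); rewrite ?normr1 ?normr0.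
  have [_ _] := dominated_convergence measurableT
    (fun n => measurable_int _ (integ_mulind (mlt n) hf))
    (measurable_int _ hf) cvgf (integrable_abse hf) dom.
  move=> H; apply: fine_cvg; rewrite fineK; first exact: H.
  exact: integrable_fin_num.
rewrite -(cvg_lim _ cvgI)//; apply: limr_le.
  by apply/cvg_ex; exists (\int[P]_w f w).
exact: nearW.
Qed.

End tails.


Section real_sequences.
Context {R : realType}.

Lemma sqrt_powR (x : R) : 0 <= x -> Num.sqrt x = x `^ (1 / 2).
Proof. by move=> x0; rewrite div1r powR12_sqrt. Qed.

Lemma powRV (x p : R) : 0 <= x -> x^-1 `^ p = x `^ (- p).
Proof. by move=> x0; rewrite -powR_inv1// -powRrM mulN1r. Qed.

Lemma sum_powR_bound (e : R) n : 0 < e ->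
  \sum_(k < n) (k.+1%:R : R) `^ (- (1 + e)) <= 1 + 1 / e.
Proof.
move=> e0; case: n => [|n]; first by rewrite big_ord0 addr_ge0// divr_ge0// ltW.
(* Induction against the first term plus the integral of [x ^ (- (1 + e))] from 1 to [n.+1]. *)
suff H : \sum_(k < n.+1) (k.+1%:R : R) `^ (- (1 + e)) <=
    1 + (1 - (n.+1%:R) `^ (- e)) / e.
  apply: le_trans H _; rewrite lerD2l; apply: ler_wpM2r.
    by rewrite invr_ge0 ltW.
  by rewrite gerBl powR_ge0.
elim: n => [|n IH].
  by rewrite big_ord_recl big_ord0 addr0 !powR1 subrr mul0r addr0.
rewrite big_ord_recr /=; apply: le_trans (lerD IH (lexx _)) _.
have [y yE] : {y : R | y = n.+2%:R} by exists n.+2%:R.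
have y1 : n.+1%:R = y - 1 :> R by rewrite yE -[n.+2]addn1 natrD addrK.
have y0 : 0 < y by rewrite yE ltr0n.
have ym0 : 0 < y - 1 by rewrite -y1 ltr0n.
rewrite y1 -yE -addrA lerD2l.
(* The integral over [[y - 1, y]] dominates the new term; this follows from [1 + s <= exp s] and
   [ln (1 - 1 / y) <= - 1 / y]. *)
have key : y `^ (- e) * (1 + e / y) <= (y - 1) `^ (- e).
  apply: (@le_trans _ _ (y `^ (- e) * expR (e / y))).
    by apply: ler_wpM2l; [exact: powR_ge0|exact: expR_ge1Dx].
  rewrite /powR !gt_eqF// -expRD ler_expR.
  have lnle : ln (y - 1) + y^-1 <= ln y.
    have -> : y - 1 = y * (1 + - y^-1) by field; rewrite gt_eqF.
    have h : 0 < 1 - y^-1 by rewrite subr_gt0 invf_lt1 ?posrE// -subr_gt0.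
    have l1 : ln (1 + - y^-1) <= - y^-1 by apply: le_ln1Dx; lra.
    rewrite lnM ?posrE//; lra.
  by have := ler_wpM2l (ltW e0) lnle; rewrite mulrDr; lra.
have -> : y `^ (- (1 + e)) = y `^ (- e) / y.
  by rewrite opprD addrC powRD ?(gt_eqF y0) ?implybT// powR_inv1 ?ltW.
rewrite -(ler_pM2r e0) mulrDl !divfK ?gt_eqF//.
have -> : y `^ (- e) / y * e = y `^ (- e) * (e / y) by field; rewrite gt_eqF.
by move: key; rewrite mulrDr mulr1; lra.
Qed.

Lemma geometric_polynomial (c p d : R) : 0 < c -> 0 <= p -> 0 < d ->
  exists N : nat, forall k, (N <= k)%N ->
    expR (- (c * k%:R)) * (k%:R : R) `^ p <= d.
Proof.
(* The exponential dominates the power [m = p + 1], and the spare factor [k] supplies the decay. *)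
move=> c0 p0 d0; pose m := p + 1.
have m0 : 0 < m by rewrite /m; lra.
pose D := (c / m) `^ m.
have D0 : 0 < D by apply: powR_gt0; exact: divr_gt0.
exists (Num.bound (D^-1 / d)).+1 => k hk.
have k0 : 0 < k%:R :> R by rewrite ltr0n (leq_trans _ hk).
have kbig : D^-1 / d <= k%:R.
  apply/ltW/(lt_le_trans (archi_boundP _)); first by rewrite divr_ge0 ?invr_ge0 ?ltW.
  by rewrite ler_nat ltnW.
have lower : D * k%:R `^ m <= expR (c * k%:R).
  rewrite /D -powRM; [|by rewrite divr_ge0// ltW|exact: ltW].
  have -> : c * k%:R = (c / m * k%:R) * m by field; rewrite gt_eqF.
  rewrite expRM; apply: ge0_ler_powR; rewrite ?nnegrE.
  - exact: ltW.
  - by rewrite mulr_ge0 ?divr_ge0 ?ltW.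
  - exact: expR_ge0.
  - by apply: le_trans (expR_ge1Dx _); lra.
rewrite expRN mulrC ler_pdivrMr ?expR_gt0//.
apply: (@le_trans _ _ (d * (D * k%:R `^ m))); last by rewrite ler_pM2l.
have -> : k%:R `^ m = k%:R `^ p * k%:R.
  by rewrite /m powRD ?(gt_eqF k0) ?implybT// powRr1 ?ltW.
have : 1 <= d * D * k%:R.
  by rewrite -ler_pdivrMl ?mulr_gt0// mulr1 invfM mulrC.
have := powR_gt0 p k0 => kp; rewrite -(ler_pM2l kp) mulr1 => /le_trans; apply.
by rewrite le_eqVlt; apply/orP; left; apply/eqP; ring.
Qed.

End real_sequences.

Lemma borel_cantelli_sum (R : realType) (d : measure_display)
    (Omega : measurableType d) (P : probability Omega R)
    (E : nat -> set Omega) (B : R) :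
  (forall k, measurable (E k)) ->
  (forall n, \sum_(k < n) fine (P (E k)) <= B) ->
  {ae P, forall w, exists N, forall k, (N <= k)%N -> ~ E k w}.
Proof.
move=> mE hB.
have : (\sum_(n <oo) P (E n) < +oo)%E.
  apply: (@le_lt_trans _ _ B%:E); last exact: ltry.
  apply: lime_le; first by apply: is_cvg_nneseries => *; exact: measure_ge0.
  apply: nearW => n; rewrite big_mkord.
  rewrite (eq_bigr (fun k : 'I_n => (fine (P (E k)))%:E)); last first.
    by move=> k _; rewrite fineK ?fin_num_measure.
  rewrite sumEFin lee_fin; exact: hB.
move=> /(lim_sup_set_cvg0 mE) E0.
have mL : measurable (lim_sup_set E).
  by apply: bigcap_measurable => // n _; apply: bigcup_measurable => k _; exact: mE.
exists (lim_sup_set E); split => // w /= nw; apply: contrapT => nL; apply: nw.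
move: nL; rewrite /lim_sup_set /= => nL.
have [N hN] : exists N, ~ (\bigcup_(j >= N) E j) w.
  by apply: contrapT => h; apply: nL => N _; apply: contrapT => h'; apply: h; exists N.
by exists N => k Nk Ek; apply: hN; exists k.
Qed.

(** * Bracket and meeting estimates *)

Section system.
Context {R : realType} (d : measure_display) (Omega : measurableType d).
Variables (P : probability Omega R) (T : R) (g : R -> R).
Variable X : R -> R -> Omega -> R.
Local Notation integ f := (P.-integrable [set: Omega] (EFin \o f)).
Local Notation F := (natural_filtration X).
Hypothesis T_gt0 : 0 < T.
Hypothesis X_D : forall w : Omega, in_D01C T (fun u t => X u t w).
Hypothesis X_C1 : C1 P T X.
Hypothesis X_C2 : C2 P g X.
Hypothesis X_C3 : C3 P T X.
Variable A : R -> R -> R -> Omega -> R.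
Hypothesis A_bracket : forall u v : R, u \in `]0, 1[ -> v \in `]0, 1[ ->
  is_bracket P T F (X u) (X v) (A u v).
Hypothesis A_clock : forall u v t : R, u \in `]0, 1[ -> v \in `]0, 1[ ->
  0 <= t <= T -> {ae P, forall w, (A u v t w)%:E = clock T X u v t w}.

Let iA u v t : u \in `]0, 1[ -> v \in `]0, 1[ -> 0 <= t <= T -> integ (A u v t).
Proof.
by move=> u01 v01; apply: (integ_bracket X_C1 u01 v01); exact: A_bracket.
Qed.

Lemma A_ge0 u v t : u \in `]0, 1[ -> v \in `]0, 1[ -> 0 <= t <= T ->
  {ae P, forall w, 0 <= A u v t w}.
Proof.
move=> u01 v01 tT; apply: filterS (A_clock u01 v01 tT) => w e.
by rewrite -lee_fin e clock_ge0.
Qed.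

Lemma A_start u v w : u \in `]0, 1[ -> v \in `]0, 1[ -> A u v 0 w = 0.
Proof. by move=> u01 v01; have [-> ] := A_bracket u01 v01. Qed.

Lemma A_increment u v s t : u \in `]0, 1[ -> v \in `]0, 1[ ->
  0 <= s -> s <= t -> t <= T ->
  {ae P, forall w, A u u s w - A u v s w <= A u u t w - A u v t w}.
Proof.
move=> u01 v01 s0 st tT.
have sT : 0 <= s <= T by rewrite s0 (le_trans st).
have tT' : 0 <= t <= T by rewrite (le_trans s0).
apply: filterS2 (filterI (A_clock u01 u01 sT) (A_clock u01 u01 tT'))
  (filterI (A_clock u01 v01 sT) (A_clock u01 v01 tT')) => w [h1 h2] [h3 h4].
exact: clock_increment h1 h2 h3 h4.
Qed.

Lemma A_diag_mono u s t : u \in `]0, 1[ -> 0 <= s -> s <= t -> t <= T ->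
  {ae P, forall w, A u u s w <= A u u t w}.
Proof.
move=> u01 s0 st tT.
have sT : 0 <= s <= T by rewrite s0 (le_trans st).
have tT' : 0 <= t <= T by rewrite (le_trans s0).
apply: filterS2 (A_clock u01 u01 sT) (A_clock u01 u01 tT') => w h1 h2.
rewrite -lee_fin h1 h2 (clock_split _ _ _ _ _ s0 st) leeDl//.
by apply: integral_ge0 => r _; exact: rate_ge0.
Qed.

Definition gap (u v t : R) (w : Omega) : R := X v t w - X u t w.

(* Using both A u v and A v u, two versions of the same bracket with the rates of u
   and of v respectively, makes this compensator visibly nondecreasing. *)
Definition gap_bracket (u v t : R) (w : Omega) : R :=
  (A u u t w - A u v t w) + (A v v t w - A v u t w).

Section pair.
Variables u v : R.
Hypothesis u01 : u \in `]0, 1[.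
Hypothesis v01 : v \in `]0, 1[.

Lemma adapted_gap : adapted T F (gap u v).
Proof.
move=> t tT B mB.
have mX p : p \in `]0, 1[ -> measurable_fun
    [set: g_sigma_algebraType [set E | exists u s : R, exists B : set R,
         [/\ u \in `]0, 1[, s \in `[0, t], measurable B &
             E = X u s @^-1` B]]] (X p t).
  move=> p01 _ C mC; rewrite setTI; apply: sub_sigma_algebra.
  exists p, t, C; split=> //.
  by move: tT; rewrite !in_itv/= => /andP[-> _] /=.
have := measurable_funB (mX _ v01) (mX _ u01) measurableT mB.
by rewrite setTI.
Qed.

Lemma continuous_gap : continuous_paths T (gap u v).
Proof.
move=> w; apply/subspace_continuousP => s sT.
have [cu _ _] := X_D w u01; have [cv _ _] := X_D w v01.
apply: cvgB; first by move/subspace_continuousP : cv; exact.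
by move/subspace_continuousP : cu; exact.
Qed.

Lemma event_martingale_gap : event_martingale_on P T F (gap u v).
Proof.
exact: (event_martingale_onB (natural_event_filtration X_C1)
  (event_martingale_X X_C1 v01) (event_martingale_X X_C1 u01)).
Qed.

Lemma integ_gap2 t : 0 <= t <= T -> integ (fun w => gap u v t w ^+ 2).
Proof.
move=> tT; have ivv := integ_XX X_C1 v01 v01 tT.
have iuu := integ_XX X_C1 u01 u01 tT.
have iuv := integ_XX X_C1 u01 v01 tT.
have := integD (integD ivv iuu) (integZ (- 2) iuv).
rewrite (_ : (fun w => _ + _ * _) = (fun w => gap u v t w ^+ 2))//.
by apply/funext => w; rewrite /gap; ring.
Qed.

Lemma integ_gap_bracket t : 0 <= t <= T -> integ (gap_bracket u v t).
Proof. by move=> tT; apply: integD; apply: integB; exact: iA. Qed.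

Lemma event_martingale_gap2 :
  event_martingale_on P T F (fun t w => gap u v t w ^+ 2 - gap_bracket u v t w).
Proof.
have Ff := natural_event_filtration X_C1.
have mart p q (p01 : p \in `]0, 1[) (q01 : q \in `]0, 1[) :=
  bracket_event_martingale (A_bracket p01 q01).
have := event_martingale_onB Ff
  (event_martingale_onB Ff
    (event_martingale_onD Ff (mart _ _ u01 u01) (mart _ _ v01 v01))
    (mart _ _ u01 v01)) (mart _ _ v01 u01).
rewrite (_ : (fun t w => gap u v t w ^+ 2 - _) = fun t w =>
  X u t w * X u t w - A u u t w + (X v t w * X v t w - A v v t w) -
  (X u t w * X v t w - A u v t w) - (X v t w * X u t w - A v u t w))//.
by apply/funext => t; apply/funext => w; rewrite /gap /gap_bracket; ring.
Qed.

Lemma gap_start : {ae P, forall w, gap u v 0 w = g v - g u}.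
Proof. by apply: filterS2 (X_C2 u01) (X_C2 v01) => w hu hv; rewrite /gap hu hv. Qed.

Lemma gap_bracket_start : {ae P, forall w, gap_bracket u v 0 w = 0}.
Proof. by apply: aeW => w; rewrite /gap_bracket !A_start// !subrr addr0. Qed.

Lemma gap_bracket_mono s t : 0 <= s -> s <= t -> t <= T ->
  {ae P, forall w, gap_bracket u v s w <= gap_bracket u v t w}.
Proof.
move=> s0 st tT.
apply: filterS2 (A_increment u01 v01 s0 st tT) (A_increment v01 u01 s0 st tT).
by move=> w h1 h2; exact: lerD.
Qed.

Lemma gap_maximal c t : 0 <= t <= T -> 0 <= c ->
  c ^+ 2 * fine (P (leaves (g v - g u) (gap u v) t c)) <=
  \int[P]_w A u u t w + \int[P]_w A v v t w.
Proof.
move=> tT c0.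
apply: le_trans (_ : \int[P]_w gap_bracket u v t w <= _).
  exact: (kolmogorov_inequality (natural_event_filtration X_C1) adapted_gap
    event_martingale_gap integ_gap2 integ_gap_bracket event_martingale_gap2
    gap_start gap_bracket_start gap_bracket_mono tT c0).
rewrite -RintegralD//; try exact: iA.
apply: ae_le_Rintegral => //; first exact: integ_gap_bracket.
  by apply: integD; exact: iA.
apply: filterS2 (A_ge0 u01 v01 tT) (A_ge0 v01 u01 tT) => w h1 h2.
by rewrite /gap_bracket; lra.
Qed.

Lemma bracket_diff_ge0 t : 0 <= t <= T ->
  {ae P, forall w, 0 <= A u u t w - A u v t w}.
Proof.
move=> /andP[t0 tT]; apply: filterS (A_increment u01 v01 (lexx 0) t0 tT) => w.
by rewrite !A_start// subrr.
Qed.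

End pair.

Lemma clock_tail_lt u v t b : u \in `]0, 1[ -> v \in `]0, 1[ -> u < v ->
  0 <= t <= T -> 0 < b ->
  fine (P [set w | b <= gap_bracket u v t w]) <= 3 * (g v - g u) / Num.sqrt b.
Proof.
move=> u01 v01 uv tT b0.
apply: (nonneg_compensator_tail (natural_event_filtration X_C1)
  (adapted_gap u01 v01) (continuous_gap u01 v01) (event_martingale_gap u01 v01)
  (integ_gap2 u01 v01) (integ_gap_bracket u01 v01)
  (event_martingale_gap2 u01 v01) (gap_start u01 v01)
  (gap_bracket_start u01 v01) (gap_bracket_mono u01 v01) tT b0) => s sT.
by apply: filterS (X_C3 u01 v01 uv sT) => w; rewrite /gap subr_ge0.
Qed.

Lemma clock_tail u v t b : u \in `]0, 1[ -> v \in `]0, 1[ -> u != v ->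
  0 <= t <= T -> 0 < b -> t <= b * `|v - u| ->
  fine (P [set w | 2 * b <= A u u t w]) <= 3 * `|g v - g u| / Num.sqrt b.
Proof.
move=> u01 v01 uv tT b0 tb; have /andP[t0 tT'] := tT.
have d0 : 0 < `|v - u| by rewrite normr_gt0 subr_eq0 eq_sym.
have mle f : integ f -> measurable [set w | b <= f w].
  move=> hf; rewrite -[X in measurable X]setTI; apply: measurable_fun_ler => //.
  exact: (integ_measurable hf).
have m2 : measurable [set w | 2 * b <= A u u t w].
  rewrite -[X in measurable X]setTI; apply: measurable_fun_ler => //.
  by apply: integ_measurable; exact: iA.
have gapC : gap_bracket u v t = gap_bracket v u t.
  by apply/funext => w; rewrite /gap_bracket addrC.
apply: le_trans (_ : fine (P [set w | b <= gap_bracket u v t w]) <= _); last first.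
  have [ltuv|ltvu|/eqP] := ltgtP u v; last by rewrite (negbTE uv).
    apply: le_trans (clock_tail_lt u01 v01 ltuv tT b0) _.
    by rewrite ler_wpM2r ?invr_ge0 ?sqrtr_ge0// ler_wpM2l// ler_norm.
  rewrite gapC; apply: le_trans (clock_tail_lt v01 u01 ltvu tT b0) _.
  by rewrite ler_wpM2r ?invr_ge0 ?sqrtr_ge0// ler_wpM2l// distrC ler_norm.
have mg := mle _ (integ_gap_bracket u01 v01 tT).
apply: ae_le_prob => //.
apply: filterS2 (ae_ordered T_gt0 X_D X_C3) (filterI (A_clock u01 v01 tT)
  (bracket_diff_ge0 v01 u01 tT)) => w ow [h1 h2] /=.
have := clock_meeting T_gt0 t0 tT' ow u01 v01 uv.
have le_b : t / `|v - u| <= b by rewrite ler_pdivrMr.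
rewrite -h1 lee_fin /gap_bracket; lra.
Qed.

(** [z] is the sign of the side on which the neighbours lie. Only one side is asked for: seen from
    [u0 +- r], condition (i) controls [g] only towards [u0]. *)
Lemma clock_expectation (u z r K beta t : R) : u \in `]0, 1[ -> `|z| = 1 ->
  0 < r -> 0 <= K -> 1 / 2 < beta -> 0 < t -> t <= T ->
  (forall rho, 0 < rho -> rho <= r -> (u + z * rho \in `]0, 1[) /\
     (`|g (u + z * rho) - g u| <= K * rho `^ beta)) ->
  \int[P]_w A u u t w <= 2 * (t / r) +
    12 / (1 - 2 `^ (1 / 2 - beta)) * (K * r `^ (beta - 1 / 2) * Num.sqrt t).
Proof.
move=> u01 z1 r0 K0 hbeta t0 tT hg.
set q : R := 2 `^ (1 / 2 - beta).
have q1 : 0 <= q < 1.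
  rewrite powR_ge0/= /q /powR gt_eqF// expR_lt1 pmulr_llt0; first lra.
  by rewrite ln_gt0// ltr1n.
rewrite (_ : 12 / (1 - q) * _ =
  12 * (K * r `^ (beta - 1 / 2) * Num.sqrt t) / (1 - q)); last first.
  by rewrite mulrAC.
have tT' : 0 <= t <= T by rewrite ltW.
apply: Rintegral_le_tails => //.
- by apply: (integ_bracket X_C1 u01 u01 _ tT'); exact: A_bracket.
- exact: divr_gt0.
- by rewrite !mulr_ge0 ?powR_ge0 ?sqrtr_ge0.
(* At level [b] the neighbour sits at distance [rho = t / b], the smallest that [clock_tail] allows.
   Doubling [b] halves [rho] and gains the ratio [q]; the factor 12 is 2 * 2 * 3. *)
move=> n; pose b := 2 ^+ n * (t / r); pose rho := r / 2 ^+ n.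
have e2 : 0 < 2 ^+ n :> R by rewrite exprn_gt0.
have rho0 : 0 < rho by rewrite divr_gt0.
have b0 : 0 < b by rewrite mulr_gt0// divr_gt0.
have rho_r : rho <= r.
  rewrite ler_pdivrMr//; apply: ler_peMr; first exact: ltW.
  by rewrite exprn_ege1// ler1n.
have [v01 gv] := hg rho rho0 rho_r.
have dist : `|u + z * rho - u| = rho.
  by rewrite addrAC subrr add0r normrM z1 mul1r gtr0_norm.
have neq : u != u + z * rho.
  apply/negP => /eqP e; move: dist; rewrite -e subrr normr0 => e'.
  by move: rho0; rewrite -e' ltxx.
have trho : t <= b * `|u + z * rho - u|.
  by rewrite dist /b /rho le_eqVlt; apply/orP; left; apply/eqP; field; rewrite !gt_eqF.
have := clock_tail u01 v01 neq tT' b0 trho.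
rewrite (_ : 2 * b = 2 ^+ n.+1 * (t / r)); last by rewrite /b exprS mulrA.
move=> tail; apply: le_trans (_ : 2 * (2 * b) * (3 * (K * rho `^ beta) / Num.sqrt b) <= _).
  rewrite (_ : 2 * b = 2 ^+ n.+1 * (t / r)); last by rewrite /b exprS mulrA.
  apply: ler_wpM2l; first by rewrite !mulr_ge0 ?exprn_ge0 ?invr_ge0 ?ltW.
  apply: le_trans tail _; rewrite ler_wpM2r ?invr_ge0 ?sqrtr_ge0//.
  by rewrite ler_wpM2l.
have sb : b / Num.sqrt b = Num.sqrt b.
  by rewrite -{1}(sqr_sqrtr (ltW b0)) expr2 mulfK// gt_eqF// sqrtr_gt0.
have bE : b = t * rho^-1 by rewrite /b /rho; field; rewrite !gt_eqF.
have sqb : Num.sqrt b = Num.sqrt t * rho `^ (- (1 / 2)).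
  by rewrite bE sqrtrM ?ltW// (sqrt_powR (x := rho^-1)) ?invr_ge0 ?ltW// powRV// ltW.
have qn : q ^+ n = (2 ^+ n) `^ (1 / 2 - beta).
  by rewrite -powR_mulrn ?powR_ge0// -powR_mulrn// -!powRrM mulrC.
have rhoE : rho `^ (beta - 1 / 2) = r `^ (beta - 1 / 2) * q ^+ n.
  rewrite /rho powRM ?invr_ge0 ?ltW// powRV ?ltW// qn; congr (_ * _ `^ _); ring.
have split : rho `^ (beta - 1 / 2) = rho `^ beta * rho `^ (- (1 / 2)).
  by rewrite -powRD// (gt_eqF rho0) implybT.
rewrite (_ : 2 * (2 * b) * (3 * (K * rho `^ beta) / Num.sqrt b) =
  12 * K * rho `^ beta * (b / Num.sqrt b)); last by ring.
rewrite sb sqb.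
rewrite (_ : _ * q ^+ n = 12 * K * Num.sqrt t * (r `^ (beta - 1 / 2) * q ^+ n)).
  by rewrite -rhoE split le_eqVlt; apply/orP; left; apply/eqP; ring.
by ring.
Qed.

Variables (alpha u0 C delta : R).
Hypothesis alpha_gt : 1 / 2 < alpha.
Hypothesis u0_in : u0 \in `]0, 1[.
Hypothesis C_gt0 : 0 < C.
Hypothesis delta_gt0 : 0 < delta.
Hypothesis delta_sub : `[u0 - delta, u0 + delta] `<=` `]0, 1[.
Hypothesis g_upper : forall u z : R, u \in `[u0 - delta, u0 + delta] ->
  Num.min 0 (u - u0) <= z -> z <= Num.max 0 (u - u0) ->
  `|g (u - z) - g u| <=
    C * `|u - u0| `^ Num.max (alpha - 1) 0 * `|z| `^ Num.min alpha 1.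
Hypothesis g_lower : forall u : R, u \in `[u0 - delta, u0 + delta] ->
  `|g u - g u0| >= 1 / C * `|u - u0| `^ alpha.

Lemma near_u0 r z : `|z| = 1 -> 0 < r -> r <= delta ->
  u0 + z * r \in `[u0 - delta, u0 + delta].
Proof.
move=> z1 r0 rd; have : `|z * r| <= delta by rewrite normrM z1 mul1r gtr0_norm.
by rewrite ler_norml in_itv/= => /andP[h1 h2]; apply/andP; split; lra.
Qed.

Lemma near_u0_in01 r z : `|z| = 1 -> 0 < r -> r <= delta -> u0 + z * r \in `]0, 1[.
Proof. by move=> z1 r0 rd; apply: delta_sub; exact: near_u0. Qed.

(** A meeting moves the gap by its full initial size. Asking for half of it leaves a strict excess,
    which continuity carries over to dyadic times. *)
Definition meeting_test (v t : R) : set Omega :=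
  leaves (g v - g u0) (gap u0 v) t (`|g v - g u0| / 2).

Lemma meeting_test_meet v s t w : v \in `]0, 1[ -> g v != g u0 -> 0 <= t <= T ->
  s \in `[0, t] -> X u0 s w = X v s w -> meeting_test v t w.
Proof.
move=> v01 gv tT st e.
have d0 : 0 < `|g v - g u0| by rewrite normr_gt0 subr_eq0.
have cg : {within `[0, T], continuous
    (fun r => `|gap u0 v r w - (g v - g u0)|)}.
  apply/subspace_continuousP => r rT; apply: cvg_norm; apply: cvgB.
    by move/subspace_continuousP : (@continuous_gap _ _ u0_in v01 w); exact.
  exact: cvg_cst.
have := grid_dense (c := `|g v - g u0| / 2) tT cg st.
rewrite {1}/gap e subrr sub0r normrN => H.
have [|n [j [jn hj]]] := H; first by lra.
exists n => //= hs; have := hs j jn => /=; rewrite leNgt hj //.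
Qed.

Lemma meeting_test_prob : exists2 k : R, 0 < k &
  forall z r t q, `|z| = 1 -> 0 < r -> r <= delta -> 0 < t -> t <= T ->
  q = Num.sqrt t * r `^ (- (alpha + 1 / 2)) ->
  fine (P (meeting_test (u0 + z * r) t)) <= k * (q ^+ 2 + q).
Proof.
set beta := Num.min alpha 1; set kap := Num.max (alpha - 1) 0.
have beta_gt : 1 / 2 < beta by rewrite lt_min alpha_gt; lra.
have kap_ge0 : 0 <= kap by rewrite le_max lexx orbT.
(* On either side of [alpha = 1] the two exponents of (i) add up to [alpha]. *)
have kb : kap + (beta - 1 / 2) = alpha - 1 / 2.
  rewrite /kap /beta; case: (leP alpha 1) => a1.
    by rewrite max_r; lra.
  by rewrite max_l; lra.
pose cb : R := 12 / (1 - 2 `^ (1 / 2 - beta)).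
have cb0 : 0 < cb.
  rewrite divr_gt0// subr_gt0 /powR gt_eqF// expR_lt1 pmulr_llt0; first lra.
  by rewrite ln_gt0// ltr1n.
(* The square of half the initial distance is at least [r ^ (2 alpha) / (4 C ^ 2)], and the two
   brackets together have mean at most [4 t / r + 2 cb C r ^ (alpha - 1/2) sqrt t]. The quotient is
   [16 C ^ 2 q ^ 2 + 8 cb C ^ 3 q]. *)
exists (16 * C ^+ 2 + 8 * cb * C ^+ 3).
  have C2 : 0 < C ^+ 2 by rewrite exprn_gt0.
  have C3 : 0 < cb * C ^+ 3 by rewrite mulr_gt0// exprn_gt0.
  by rewrite -mulrA; lra.
move=> z r t q z1 r0 rd t0 tT qE.
set v := u0 + z * r.
have v01 : v \in `]0, 1[ by exact: near_u0_in01.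
have tT' : 0 <= t <= T by rewrite ltW.
have zpm : z = 1 \/ z = - 1.
  have := ler_norm z; have : `|z| = z \/ `|z| = - z.
    by case: (leP 0 z) => h; [left; rewrite ger0_norm|right; rewrite ltr0_norm].
  by rewrite z1 => -[] h _; [left|right]; lra.
have K0 : 0 <= C * r `^ kap by rewrite mulr_ge0 ?powR_ge0// ltW.
have vu0 : v - u0 = z * r by rewrite /v addrAC subrr add0r.
have nzr rho : 0 < rho -> `|z * rho| = rho.
  by move=> rho0; rewrite normrM z1 mul1r gtr0_norm.
have E1 := @clock_expectation u0 z r _ beta t u0_in z1 r0 K0 beta_gt t0 tT.
have E2 := @clock_expectation v (- z) r _ beta t v01 (etrans (normrN z) z1) r0 K0 beta_gt t0 tT.
have {}E1 := E1 _; have {}E2 := E2 _.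
have {}E1 : \int[P]_w A u0 u0 t w <= 2 * (t / r) +
    cb * (C * r `^ kap * r `^ (beta - 1 / 2) * Num.sqrt t).
  (* Here (i) is read at the neighbour [u0 + z * rho], with the displacement leading back to [u0];
     its prefactor [rho ^ kap] is at most [r ^ kap]. *)
  apply: E1 => rho rho0 rhor; split; first exact: near_u0_in01 (le_trans rhor rd).
  have := g_upper (near_u0 z1 rho0 (le_trans rhor rd)) (z := z * rho).
  rewrite addrK (addrAC u0) subrr add0r (nzr _ rho0) distrC => H.
  apply: le_trans (H _ _) _.
  - by rewrite ge_min lexx orbT.
  - by rewrite le_max lexx orbT.
  - apply: ler_wpM2r; first exact: powR_ge0.
    apply: ler_wpM2l; first exact: ltW.
    by apply: ge0_ler_powR => //; rewrite nnegrE ltW.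
have {}E2 : \int[P]_w A v v t w <= 2 * (t / r) +
    cb * (C * r `^ kap * r `^ (beta - 1 / 2) * Num.sqrt t).
  (* Here (i) is read at [v], with neighbours on the way back to [u0]. The case [rho = r] is [u0]
     itself, which [near_u0_in01] does not cover. *)
  apply: E2 => rho rho0 rhor; split.
    rewrite /v -addrA mulNr -mulrBr; have [->|rr] := eqVneq rho r.
      by rewrite subrr mulr0 addr0.
    apply: near_u0_in01 => //; first by rewrite subr_gt0 lt_neqAle rr.
    by lra.
  have := g_upper (near_u0 z1 r0 rd) (z := z * rho).
  rewrite -/v vu0 (nzr _ r0) (nzr _ rho0) mulNr; apply.
  - rewrite ge_min; case: zpm => ->; rewrite ?mul1r ?mulN1r.
      by rewrite ltW.
    by rewrite lerN2 rhor orbT.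
  - rewrite le_max; case: zpm => ->; rewrite ?mul1r ?mulN1r.
      by rewrite rhor orbT.
    by rewrite oppr_le0 ltW.
have lower : 1 / C * r `^ alpha <= `|g v - g u0|.
  by have := g_lower (near_u0 z1 r0 rd); rewrite -/v vu0 (nzr _ r0).
have ra0 : 0 < r `^ alpha by rewrite powR_gt0.
set x := `|g v - g u0| in lower *.
have x0 : 0 < x by apply: lt_le_trans lower; rewrite mulr_gt0// divr_gt0.
have max_ineq := gap_maximal u0_in v01 tT'
  (divr_ge0 (ltW x0) (ler0n R 2)).
rewrite -/(meeting_test v t) in max_ineq.
set p := fine (P (meeting_test v t)) in max_ineq *.
have p0 : 0 <= p by rewrite fine_ge0.
have E12 : (x / 2) ^+ 2 * p <=
    4 * (t / r) + 2 * cb * C * (r `^ (alpha - 1 / 2) * Num.sqrt t).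
  apply: le_trans max_ineq _; apply: le_trans (lerD E1 E2) _.
  rewrite -(mulrA C) -powRD ?kb; last by rewrite (gt_eqF r0) implybT.
  by rewrite le_eqVlt; apply/orP; left; apply/eqP; ring.
have x2 : (r `^ alpha) ^+ 2 <= C ^+ 2 * x ^+ 2.
  rewrite -exprMn; apply: lerXn2r; rewrite ?nnegrE.
  - exact: ltW.
  - by rewrite mulr_ge0// ltW.
  - by move: lower; rewrite div1r ler_pdivrMl.
have q0 : 0 <= q by rewrite qE mulr_ge0 ?sqrtr_ge0 ?powR_ge0.
have rh : r `^ (1 / 2) * r `^ (1 / 2) = r.
  by rewrite -powRD ?(gt_eqF r0) ?implybT// (_ : 1 / 2 + 1 / 2 = 1)
    ?powRr1 ?ltW//; field.
have rD : r `^ (- (alpha + 1 / 2)) = (r `^ alpha * r `^ (1 / 2))^-1.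
  by rewrite powRN powRD// (gt_eqF r0) implybT.
have rB : r `^ (alpha - 1 / 2) = r `^ alpha / r `^ (1 / 2).
  by rewrite powRB// (gt_eqF r0) implybT.
have h0 : 0 < r `^ (1 / 2) by rewrite powR_gt0.
have t2 : Num.sqrt t * Num.sqrt t = t by rewrite -expr2 sqr_sqrtr ?ltW.
have q2E : (r `^ alpha) ^+ 2 * q ^+ 2 = t / r.
  have -> : t / r = Num.sqrt t * Num.sqrt t / (r `^ (1 / 2) * r `^ (1 / 2)).
    by rewrite t2 rh.
  by rewrite qE rD; field; rewrite !gt_eqF.
have q1E : (r `^ alpha) ^+ 2 * q = r `^ (alpha - 1 / 2) * Num.sqrt t.
  by rewrite qE rD rB; field; rewrite !gt_eqF.
rewrite -q2E -q1E in E12.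
have ra2 : 0 < (r `^ alpha) ^+ 2 by rewrite exprn_gt0.
have step : (r `^ alpha) ^+ 2 * p <= (r `^ alpha) ^+ 2 *
    (4 * C ^+ 2 * (4 * q ^+ 2 + 2 * cb * C * q)).
  apply: (@le_trans _ _ (C ^+ 2 * x ^+ 2 * p)); first by rewrite ler_wpM2r.
  rewrite (_ : C ^+ 2 * x ^+ 2 * p = 4 * C ^+ 2 * ((x / 2) ^+ 2 * p)); last by field.
  apply: le_trans (_ : 4 * C ^+ 2 * _ <= _).
    by apply: ler_wpM2l E12; rewrite mulr_ge0// exprn_ge0 ?ltW.
  by rewrite le_eqVlt; apply/orP; left; apply/eqP; ring.
rewrite ler_pM2l// in step; apply: le_trans step _.
rewrite (_ : 4 * C ^+ 2 * _ = 16 * C ^+ 2 * q ^+ 2 + 8 * cb * C ^+ 3 * q); last by ring.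
have a0 : 0 <= 16 * C ^+ 2 by rewrite mulr_ge0// exprn_ge0 ?ltW.
have b0 : 0 <= 8 * cb * C ^+ 3.
  by apply: mulr_ge0; [rewrite mulr_ge0// ltW|rewrite exprn_ge0 ?ltW].
have q20 : 0 <= q ^+ 2 by rewrite exprn_ge0.
by rewrite mulrDl !mulrDr; have := mulr_ge0 a0 q0; have := mulr_ge0 b0 q20; lra.
Qed.

Let gam : R := 1 / (2 * alpha + 1).

Let gam_gt0 : 0 < gam.
Proof. by rewrite /gam div1r invr_gt0; have := alpha_gt; lra. Qed.

Lemma g_neq_near r z : `|z| = 1 -> 0 < r -> r <= delta ->
  g (u0 + z * r) != g u0.
Proof.
move=> z1 r0 rd; have := g_lower (near_u0 z1 r0 rd).
rewrite div1r addrAC subrr add0r normrM z1 mul1r gtr0_norm//.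
rewrite -subr_eq0 -normr_gt0; apply: lt_le_trans.
by apply: mulr_gt0; [rewrite invr_gt0|exact: powR_gt0].
Qed.

Definition dyadic_time (k : nat) : R := (2 ^+ k.+1)^-1.
(** [k.+1] is [ln (1 / t)] divided by [ln 2]; an exponent [p > 1] makes the meeting probabilities
    summable. *)
Definition dyadic_radius (p : R) (k : nat) : R :=
  dyadic_time k `^ gam * k.+1%:R `^ p.

Lemma dyadic_time_gt0 k : 0 < dyadic_time k.
Proof. by rewrite invr_gt0 exprn_gt0. Qed.

Lemma dyadic_time_anti m n : (m <= n)%N -> dyadic_time n <= dyadic_time m.
Proof.
move=> mn; rewrite lef_pV2 ?posrE ?exprn_gt0//.
by rewrite ler_eXn2l ?ltnS// ltr1n.
Qed.

Lemma dyadic_time_small (e : R) : 0 < e -> exists n, dyadic_time n < e.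
Proof.
move=> e0; exists (Num.bound e^-1).
rewrite invf_plt ?posrE ?exprn_gt0//.
have := archi_boundP (ltW (_ : 0 < e^-1)); rewrite invr_gt0 => /(_ e0) /lt_trans; apply.
by rewrite -natrX ltr_nat (ltn_trans (ltnSn _))// ltn_expl.
Qed.

Lemma dyadic_radius_gt0 p k : 0 < dyadic_radius p k.
Proof.
by apply: mulr_gt0; apply: powR_gt0 => //; exact: dyadic_time_gt0.
Qed.

Lemma dyadic_radius_small p : 0 <= p ->
  exists N, forall k, (N <= k)%N -> dyadic_radius p k <= delta.
Proof.
move=> p0; have c0 : 0 < gam * ln 2 by rewrite mulr_gt0// ln_gt0// ltr1n.
have [N hN] := geometric_polynomial c0 p0 delta_gt0.
exists N => k Nk; apply: le_trans (hN k.+1 _); last exact: leqW.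
rewrite /dyadic_radius le_eqVlt; apply/orP; left; apply/eqP; congr (_ * _).
rewrite /powR gt_eqF ?dyadic_time_gt0// /dyadic_time.
by rewrite lnV ?posrE ?exprn_gt0// lnXn// -mulr_natr; congr expR; ring.
Qed.

Lemma ae_no_meeting p : 1 < p -> {ae P, forall w, exists N, forall k, (N <= k)%N ->
  [/\ dyadic_radius p k <= delta, dyadic_time k <= T &
      forall z, (z = 1 \/ z = -1) ->
        ~ meeting_test (u0 + z * dyadic_radius p k) (dyadic_time k) w]}.
Proof.
move=> p1; set r := dyadic_radius p; set t := dyadic_time.
have [kc kc0 hk] := meeting_test_prob.
pose ok k := (r k <= delta) && (t k <= T).
pose D z k : set Omega := meeting_test (u0 + z * r k) (t k).
(* For finitely many indices the radius or the time is out of range; the empty event stands in for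
   them. *)
pose E k : set Omega := if ok k then D 1 k `|` D (-1) k else set0.
have norm1 (z : R) : z = 1 \/ z = -1 -> `|z| = 1.
  by case=> ->; rewrite ?normrN normr1.
have r0 k : 0 < r k by exact: dyadic_radius_gt0.
have t0 k : 0 < t k by exact: dyadic_time_gt0.
have mD z k : z = 1 \/ z = -1 -> ok k -> measurable (D z k).
  move=> z1 /andP[rd tT].
  have v01 := near_u0_in01 (norm1 _ z1) (r0 k) rd.
  have tT' : 0 <= t k <= T by rewrite tT andbT ltW.
  exact: (measurable_leaves (natural_event_filtration X_C1) _
    (adapted_gap u0_in v01) tT' _).
have pE k : fine (P (E k)) <= 4 * kc * k.+1%:R `^ (- p).
  rewrite /E; case: ifPn => [okk|_]; last first.
    by rewrite measure0 /= !mulr_ge0 ?powR_ge0// ltW.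
  have /andP[rd tT] := okk.
  have pD z : z = 1 \/ z = -1 -> fine (P (D z k)) <= 2 * kc * k.+1%:R `^ (- p).
    move=> z1; apply: le_trans (hk z (r k) (t k) _ (norm1 _ z1) (r0 k) rd (t0 k) tT erefl) _.
    set q := Num.sqrt _ * _.
    have q_le : q <= k.+1%:R `^ (- p).
      have -> : q = k.+1%:R `^ (p * - (alpha + 1 / 2)).
        rewrite /q /r /dyadic_radius powRM ?powR_ge0// -!powRrM -/t.
        rewrite (_ : gam * - (alpha + 1 / 2) = - (1 / 2)); last first.
          by rewrite /gam; field; rewrite gt_eqF//; have := alpha_gt; lra.
        rewrite powRN mulrA -sqrt_powR ?ltW// divff ?mul1r//.
        by rewrite gt_eqF// sqrtr_gt0.
      (* Since [alpha + 1 / 2 > 1], the exponent can be weakened to [- p]. *)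
      apply: ler_powR; first by rewrite ler1n.
      have : 0 <= p * (alpha - 1 / 2).
        by apply: mulr_ge0; [|have := alpha_gt]; lra.
      lra.
    have q0 : 0 <= q by rewrite mulr_ge0 ?sqrtr_ge0 ?powR_ge0.
    have q1 : q <= 1.
      apply: le_trans q_le _; rewrite -[leRHS](powRr0 k.+1%:R).
      by apply: ler_powR; [rewrite ler1n|lra].
    have q2 : q ^+ 2 <= q by rewrite expr2 ler_piMl.
    rewrite -mulrA mulrCA; apply: ler_wpM2l; first exact: ltW.
    lra.
  have m1 := mD 1 k (or_introl erefl) okk.
  have m2 := mD (-1) k (or_intror erefl) okk.
  apply: le_trans (fine_probU P m1 m2) _.
  by have := pD 1 (or_introl erefl); have := pD (-1) (or_intror erefl); lra.
have mE k : measurable (E k).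
  rewrite /E; case: ifPn => [okk|_]; last exact: measurable0.
  by apply: measurableU; apply: mD => //; [left|right].
have sE n : \sum_(k < n) fine (P (E k)) <= 4 * kc * (1 + 1 / (p - 1)).
  apply: le_trans (_ : \sum_(k < n) 4 * kc * k.+1%:R `^ (- p) <= _).
    by apply: ler_sum => k _; exact: pE.
  rewrite -mulr_sumr; apply: ler_wpM2l; first by rewrite mulr_ge0// ltW.
  have p10 : 0 < p - 1 by rewrite subr_gt0.
  by have := sum_powR_bound n p10; rewrite (_ : 1 + (p - 1) = p)//; ring.
apply: filterS (borel_cantelli_sum mE sE) => w [N1 hN1].
have [N2 hN2] := dyadic_radius_small (ltW (lt_trans ltr01 p1)).
have [N3 hN3] := dyadic_time_small T_gt0.
exists (maxn N1 (maxn N2 N3)) => k; rewrite !geq_max => /and3P[k1 k2 k3].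
have rd : r k <= delta by exact: hN2.
have tT : t k <= T by apply: le_trans (ltW hN3); exact: dyadic_time_anti.
split=> // z z1 Dz; apply: (hN1 k k1); rewrite /E /ok rd tT /=.
by case: z1 Dz => ->; [left|right].
Qed.

(** The factor 2 is the length of [[u0 - r, u0 + r]] divided by [r], the power of 2 pays for
    replacing [t] by a dyadic time at most [2 t], and the power of [ln 2] turns [k.+1] into
    [ln (1 / t)]. *)
Definition mass_const (p : R) : R := 2 * 2 `^ gam * (ln 2) `^ (- p).

Lemma mass_const_gt0 p : 0 < mass_const p.
Proof.
have l2 : 0 < ln 2 :> R by rewrite ln_gt0// ltr1n.
by apply: mulr_gt0; [apply: mulr_gt0 => //|]; exact: powR_gt0.
Qed.

Lemma mass_bound p : 1 < p -> {ae P, forall w, exists2 t0, 0 < t0 <= 1 / 2 &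
  forall t, 0 < t -> t < t0 -> t <= T /\
    (mass X u0 t w <= (mass_const p * t `^ gam * ln (1 / t) `^ p)%:E)%E}.
Proof.
move=> p1.
apply: filterS2 (ae_ordered T_gt0 X_D X_C3) (ae_no_meeting p1) => w ow [N hN].
exists (dyadic_time N).
  rewrite dyadic_time_gt0/= div1r; apply: le_trans (dyadic_time_anti (leq0n N)) _.
  by rewrite /dyadic_time expr1.
move=> t t0 tN.
(* The least such [j] is [k.+1], where [t] lies between [dyadic_time k.+1] and [dyadic_time k]. *)
have [j jt jmin] := ex_minnP (dyadic_time_small t0).
have Nj : (N < j)%N.
  rewrite ltnNge; apply/negP => /dyadic_time_anti jN.
  by have := lt_trans jt tN; rewrite ltNge jN.
case: j jt jmin Nj => // k jt jmin Nk; rewrite ltnS in Nk.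
have tk : t <= dyadic_time k.
  by rewrite leNgt; apply/negP => /jmin; rewrite ltnn.
have [rd tT nomeet] := hN k Nk.
have r0 := dyadic_radius_gt0 p k.
split; first exact: le_trans tk tT.
apply: le_trans (mass_le X u0 w tk) _.
have in01 z : `|z| = 1 -> u0 + z * dyadic_radius p k \in `]0, 1[.
  by move=> z1; exact: (near_u0_in01 z1 r0 rd).
have r01 : u0 + dyadic_radius p k \in `]0, 1[.
  by have := in01 1 (normr1 _); rewrite mul1r.
have l01 : u0 - dyadic_radius p k \in `]0, 1[.
  by have := in01 (-1); rewrite normrN normr1 mulN1r; exact.
apply: le_trans (mass_no_meeting ow tT r0 u0_in l01 r01 _) _.
  move=> v hv s st e.
  have [z z1 vz] : exists2 z : R, z = 1 \/ z = -1 & v = u0 + z * dyadic_radius p k.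
    case: hv => ->; first by exists (-1); [right|rewrite mulN1r].
    by exists 1; [left|rewrite mul1r].
  apply: (nomeet z z1).
  have nz : `|z| = 1 by case: z1 => ->; rewrite ?normrN normr1.
  apply: (meeting_test_meet _ _ _ st); rewrite -?vz//.
  - by rewrite vz; exact: in01.
  - by rewrite vz; exact: g_neq_near.
  - by rewrite tT ltW// dyadic_time_gt0.
rewrite lee_fin /mass_const /dyadic_radius.
have l2 : 0 < ln 2 :> R by rewrite ln_gt0// ltr1n.
have p0 : 0 <= p by rewrite ltW// (lt_trans ltr01).
have h1 : dyadic_time k `^ gam <= 2 `^ gam * t `^ gam.
  rewrite -powRM; [|by []|exact: ltW]; apply: ge0_ler_powR; rewrite ?nnegrE.
  - exact: ltW.
  - exact/ltW/dyadic_time_gt0.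
  - by rewrite mulr_ge0// ltW.
  - have -> : dyadic_time k = 2 * dyadic_time k.+1.
      by rewrite /dyadic_time [in RHS]exprS invfM mulrA divff// mul1r.
    by rewrite ler_pM2l// ltW.
have lnt : k.+1%:R * ln 2 <= ln (1 / t).
  rewrite mulr_natl -lnXn// ler_ln ?posrE ?exprn_gt0 ?divr_gt0//.
  by rewrite div1r -(invrK (2 ^+ _)) lef_pV2 ?posrE// dyadic_time_gt0.
have h2 : k.+1%:R `^ p <= (ln 2) `^ (- p) * ln (1 / t) `^ p.
  have lnt0 : 0 <= ln (1 / t).
    by apply: le_trans lnt; rewrite mulr_ge0// ltW.
  rewrite -powRV; last exact: ltW.
  rewrite -powRM; [|by rewrite invr_ge0 ltW|exact: lnt0].
  apply: ge0_ler_powR; rewrite ?nnegrE//.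
  - by rewrite mulr_ge0// invr_ge0 ltW.
  - by rewrite mulrC ler_pdivlMr.
rewrite (_ : 2 * 2 `^ gam * _ * _ * _ =
  2 * (2 `^ gam * t `^ gam * (ln 2 `^ (- p) * ln (1 / t) `^ p))); last by ring.
by rewrite ler_pM2l//; apply: ler_pM => //; exact: powR_ge0.
Qed.

End system.

(** * Small-time asymptotics *)

Section main_asymptotics.
Context {R : realType} (d : measure_display) (Omega : measurableType d).
Variables (P : probability Omega R) (T : R) (g : R -> R).
Variable X : R -> R -> Omega -> R.
Local Notation F := (natural_filtration X).
Hypothesis T_gt0 : 0 < T.
Hypothesis X_D : forall w : Omega, in_D01C T (fun u t => X u t w).
Hypothesis X_C1 : C1 P T X.
Hypothesis X_C2 : C2 P g X.
Variable u0 : R.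
Hypothesis u0_in : u0 \in `]0, 1[.
Variables (alpha : R) (mass_c : R -> R).
Hypothesis alpha_gt : 1 / 2 < alpha.
Hypothesis mass_c_gt0 : forall p, 0 < mass_c p.
Hypothesis mass_le_c : forall p, 1 < p ->
  {ae P, forall w, exists2 t0, 0 < t0 <= 1 / 2 &
  forall t, 0 < t -> t < t0 -> t <= T /\
    (mass X u0 t w <=
      (mass_c p * t `^ (1 / (2 * alpha + 1)) * ln (1 / t) `^ p)%:E)%E}.

Lemma ln_inv_gt0 (t : R) : 0 < t -> t < 1 -> 0 < ln (1 / t).
Proof. by move=> t0 t1; rewrite ln_gt0// div1r invf_gt1. Qed.

Lemma mass_limit eps : 0 < eps -> {ae P, forall w,
  fine (mass X u0 t w) /
    (t `^ (1 / (2 * alpha + 1)) * ln (1 / t) `^ (1 + eps))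
  @[t --> 0^'+] --> (0 : R)}.
Proof.
(* Half of [eps] is spent on the almost sure bound; the other half makes the quotient vanish. *)
move=> eps0; set p := 1 + eps / 2; set c := mass_c p.
have p1 : 1 < p by rewrite /p; lra.
have c0 : 0 < c by exact: mass_c_gt0.
apply: filterS (mass_le_c p1) => w [t0 /andP[t00 t0h] ht].
apply/cvgrPdist_lt => e e0.
(* [L0] solves [L0 ^ (eps / 2) = c / e], and [t < exp (- L0)] means [ln (1 / t) > L0]. *)
pose L0 := (c / e) `^ (2 / eps).
have L00 : 0 < L0 by apply: powR_gt0; exact: divr_gt0.
exists (Num.min t0 (expR (- L0))) => /=; first by rewrite lt_min t00 expR_gt0.
move=> t /=; rewrite !sub0r !normrN => + tpos; rewrite gtr0_norm// lt_min.
move=> /andP[tt0 tL].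
have [_ hm] := ht t tpos tt0.
have t1 : t < 1 by lra.
have L_gt0 := ln_inv_gt0 tpos t1; set L := ln (1 / t) in hm L_gt0 *.
have LL : L0 < L.
  rewrite /L div1r lnV ?posrE// ltrNr -ltr_expR lnK ?posrE//.
set tg := t `^ (1 / (2 * alpha + 1)) in hm *.
have tg0 : 0 < tg by exact: powR_gt0.
have Lp q : 0 < L `^ q by exact: powR_gt0.
have m0 : 0 <= fine (mass X u0 t w) by rewrite fine_ge0// mass_ge0.
have mle : fine (mass X u0 t w) <= c * tg * L `^ p.
  by rewrite -lee_fin fineK// mass_fin_num.
rewrite ger0_norm; last first.
  by apply: divr_ge0 => //; apply: mulr_ge0; exact: ltW.
rewrite ltr_pdivrMr; last exact: mulr_gt0.
apply: le_lt_trans mle _.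
have -> : L `^ (1 + eps) = L `^ p * L `^ (eps / 2).
  by rewrite -powRD ?(gt_eqF L_gt0) ?implybT// /p; congr (_ `^ _); field.
have cL : c / e < L `^ (eps / 2).
  have -> : c / e = L0 `^ (eps / 2).
    rewrite /L0 -powRrM (_ : 2 / eps * (eps / 2) = 1); last by field; rewrite gt_eqF.
    by rewrite powRr1// divr_ge0// ltW.
  by apply: gt0_ltr_powR; rewrite ?nnegrE ?ltW// divr_gt0.
rewrite ltr_pdivrMr// in cL.
rewrite (_ : e * _ = L `^ (eps / 2) * e * (tg * L `^ p)); last by ring.
rewrite -mulrA ltr_pM2r//; exact: mulr_gt0.
Qed.

Variable A : R -> Omega -> R.
Hypothesis A_bracket : is_bracket P T F (X u0) (X u0) A.
Hypothesis A_clock : forall t : R, 0 <= t <= T ->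
  {ae P, forall w, (A t w)%:E = clock T X u0 u0 t w}.
Hypothesis A_mono : forall s t, 0 <= s -> s <= t -> t <= T ->
  {ae P, forall w, A s w <= A t w}.

(* Doubly exponential times make the escape probabilities geometrically small. *)
Definition escape_time (k : nat) : R := expR (- 2 ^+ k).

Let ln_time k : ln (1 / escape_time k) = 2 ^+ k.
Proof. by rewrite div1r /escape_time -expRN opprK expRK. Qed.

Let time_gt0 k : 0 < escape_time k. Proof. exact: expR_gt0. Qed.

Lemma time_small (e : R) : 0 < e -> exists N, forall k, (N <= k)%N -> escape_time k < e.
Proof.
move=> e0; exists (Num.bound `|ln e|) => k hk.
rewrite -[ltRHS]lnK ?posrE// /escape_time ltr_expR ltrNl.
have h : `|ln e| < 2 ^+ k.
  apply: lt_le_trans (archi_boundP (normr_ge0 _)) _.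
  by rewrite -natrX ler_nat (leq_trans hk)// ltnW// ltn_expl.
by apply: le_lt_trans h; rewrite -normrN ler_norm.
Qed.

(** With [x = 2 ^ k = ln (1 / t)], the ratio [a ^ 2 / b] is [x ^ (- eps / 2)], geometric in [k],
    while [a] exceeds the normalisation of the limsup by [x ^ (eps / 2)] up to a constant. The
    constant [c] will be the inverse of the mass constant, so that [b] bounds the bracket from
    below. *)
Lemma escape eps (c : R) : 0 < eps -> 0 < c ->
  let th := alpha / (2 * alpha + 1) in
  let a k := Num.sqrt c * escape_time k `^ th * (2 ^+ k) `^ (- (1 / 2 + eps / 2)) in
  let b k := c * escape_time k `^ (2 * th) * (2 ^+ k) `^ (- (1 + eps / 2)) in
  {ae P, forall w, exists N, forall k, (N <= k)%N -> escape_time k <= T ->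
     b k <= A (escape_time k) w -> leaves (g u0) (X u0) (escape_time k) (a k) w}.
Proof.
move=> eps0 c0 th a b.
have a0 k : 0 < a k.
  apply: mulr_gt0; last by apply: powR_gt0; rewrite exprn_gt0.
  by apply: mulr_gt0; [rewrite sqrtr_gt0|exact: powR_gt0].
have b0 k : 0 < b k.
  apply: mulr_gt0; last by apply: powR_gt0; rewrite exprn_gt0.
  by apply: mulr_gt0 => //; exact: powR_gt0.
set q : R := 2 `^ (- (eps / 2)).
have q01 : 0 <= q < 1.
  rewrite powR_ge0/= /q /powR gt_eqF// expR_lt1 pmulr_llt0; first lra.
  by rewrite ln_gt0// ltr1n.
have /andP[q0 q1] := q01.
have pow2 (x y : R) : (x `^ y) ^+ 2 = x `^ (2 * y).
  by rewrite -powR_mulrn ?powR_ge0// -powRrM mulrC.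
have ab k : a k ^+ 2 = q ^+ k * b k.
  have -> : q ^+ k = (2 ^+ k) `^ (- (eps / 2)).
    have h1 : q `^ k%:R = q ^+ k := powR_mulrn k q0.
    have h2 : 2 `^ k%:R = 2 ^+ k :> R := powR_mulrn k (ler0n R 2).
    by rewrite -h1 -h2 /q -[LHS]powRrM -[RHS]powRrM [in LHS]mulrC.
  have x0 : 0 < 2 ^+ k :> R by rewrite exprn_gt0.
  rewrite /a /b; move: (2 ^+ k) x0 => x x0.
  rewrite !exprMn !pow2 sqr_sqrtr ?ltW//.
  have -> : x `^ (2 * - (1 / 2 + eps / 2)) =
      x `^ (- (eps / 2)) * x `^ (- (1 + eps / 2)).
    rewrite -powRD ?(gt_eqF x0) ?implybT//.
    by have -> : 2 * - (1 / 2 + eps / 2) = - (eps / 2) + - (1 + eps / 2) by field.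
  by ring.
pose E k := if escape_time k <= T
  then [set w | b k <= A (escape_time k) w] `\` leaves (g u0) (X u0) (escape_time k) (a k)
  else set0.
have Ff := natural_event_filtration X_C1.
have [[M_ad _ _] M_cont M_sq] := X_C1 u0_in.
have M_mart := event_martingale_X X_C1 u0_in.
have iA t : 0 <= t <= T -> P.-integrable setT (EFin \o A t).
  exact: (integ_bracket X_C1 u0_in u0_in A_bracket).
have tT k : escape_time k <= T -> 0 <= escape_time k <= T by move=> ->; rewrite ltW.
have mE k : measurable (E k).
  rewrite /E; case: ifPn => [kT|_]; last exact: measurable0.
  apply: measurableD; last exact: (measurable_leaves Ff _ M_ad (tT _ kT)).
  rewrite -[X in measurable X]setTI; apply: measurable_fun_ler => //.
  exact: integ_measurable (iA _ (tT _ kT)).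
have iM2 t : 0 <= t <= T -> P.-integrable setT (EFin \o (fun w => X u0 t w ^+ 2)).
  by move=> tT'; apply: M_sq; rewrite in_itv.
have MA_mart : event_martingale_on P T F (fun t w => X u0 t w ^+ 2 - A t w).
  have := bracket_event_martingale A_bracket.
  by under eq_fun do under eq_fun do rewrite -expr2.
have A0 : {ae P, forall w, A 0 w = 0} by apply: aeW; case: A_bracket.
have pE k : fine (P (E k)) <= 4 * q ^+ k.
  rewrite /E; case: ifPn => [kT|_]; last first.
    by rewrite measure0 /= mulr_ge0// exprn_ge0.
  have := stays_compensator_bound Ff M_ad M_cont M_mart iM2 iA MA_mart
    (X_C2 u0_in) A0 A_mono (tT _ kT) (a0 k) (b0 k).
  by rewrite ab mulrA mulrC ler_pM2r.
have sE n : \sum_(k < n) fine (P (E k)) <= 4 / (1 - q).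
  apply: le_trans (_ : 4 * ((1 - q ^+ n) / (1 - q)) <= _).
    elim: n => [|n IH]; first by rewrite big_ord0 expr0 subrr mul0r mulr0.
    rewrite big_ord_recr /=; apply: le_trans (lerD IH (pE n)) _.
    by rewrite le_eqVlt; apply/orP; left; apply/eqP; rewrite exprS; field;
       rewrite gt_eqF// subr_gt0.
  apply: ler_wpM2l => //; rewrite -[leRHS]mul1r; apply: ler_wpM2r.
    by rewrite invr_ge0 subr_ge0 ltW.
  by rewrite gerBl exprn_ge0.
apply: filterS (borel_cantelli_sum mE sE) => w [N hN].
exists N => k Nk kT bA; apply: contrapT => nl.
by apply: (hN k Nk); rewrite /E kT.
Qed.

Lemma position_limsup eps : 0 < eps -> {ae P, forall w,
  limf_esup (fun t : R =>
    (`|X u0 t w - g u0| /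
      (t `^ (alpha / (2 * alpha + 1)) *
       ln (1 / t) `^ (- (1 / 2) - eps)))%:E) 0^'+ = +oo%E}.
Proof.
move=> eps0; set th := alpha / (2 * alpha + 1).
set p := 1 + eps / 2; set c := mass_c p.
have p1 : 1 < p by rewrite /p; lra.
have c0 : 0 < c by exact: mass_c_gt0.
have ci0 : 0 < c^-1 by rewrite invr_gt0.
have al : 0 < 2 * alpha + 1 by have := alpha_gt; lra.
have th2 : 1 / (2 * alpha + 1) = 1 - 2 * th by rewrite /th; field; rewrite gt_eqF.
have th0 : 0 <= th by rewrite divr_ge0//; have := alpha_gt; lra.
(* The clock identity is used only at the countably many escape times, hence off a single null
   set. *)
have clocks : {ae P, forall w, forall k, escape_time k <= T ->
    (A (escape_time k) w)%:E = clock T X u0 u0 (escape_time k) w}.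
  apply: ae_foralln => k; case: (leP (escape_time k) T) => kT; last exact: aeW.
  have kT' : 0 <= escape_time k <= T by rewrite kT ltW.
  by apply: filterS (A_clock kT') => w e _.
apply: filterS2 (filterI (mass_le_c p1) clocks)
  (filterI (escape eps0 ci0) (X_C2 u0_in)) => w [[t0 /andP[t00 t0h] ht] hclock].
move=> [[N hN] start].
rewrite limf_esupE; apply/eqP; rewrite -leye_eq; apply: le_ereal_inf_tmp => _ [V V0 <-].
rewrite leye_eq; apply/eqP/eqyP => M M0.
have [r r0 hr] := V0; rewrite /= in r0.
have tr0 : 0 < Num.min t0 r by rewrite lt_min t00.
have [N1 hN1] := time_small tr0.
have [cc cc0 ccE] : exists2 cc, 0 < cc & cc = Num.sqrt c^-1.
  by exists (Num.sqrt c^-1); rewrite ?sqrtr_gt0.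
(* The last condition makes [cc * (2 ^ k) ^ (eps / 2)], the factor gained over the normalisation, at
   least [M]. *)
have [k [kN kN1 kM]] : exists k, [/\ (N <= k)%N, (N1 <= k)%N &
    (M / cc) `^ (2 / eps) <= 2 ^+ k].
  exists (maxn N (maxn N1 (Num.bound ((M / cc) `^ (2 / eps))))); split.
  - exact: leq_maxl.
  - by rewrite maxnCA leq_maxl.
  - apply: le_trans (ltW (archi_boundP (powR_ge0 _ _))) _.
    rewrite -natrX ler_nat; apply: leq_trans (ltnW (ltn_expl _ (ltnSn 1))) _.
    by rewrite leq_exp2l// maxnA leq_maxr.
have := hN1 k kN1; rewrite lt_min => /andP[].
have := ht _ (time_gt0 k); have := time_gt0 k; have := ln_time k.
have := hclock k; have := hN k kN; have : 0 < 2 ^+ k :> R by rewrite exprn_gt0.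
move: (escape_time k) (2 ^+ k) kM => tk x kM x0 leave_tk clock_tk ln_tk tk0.
move=> /[swap] kt0 /(_ kt0) [kT hm] kr {hN hclock}.
have t0h1 : t0 < 1 by apply: le_lt_trans t0h _; rewrite ltr_pdivrMr// mul1r ltr1n.
have tk1 : tk < 1 by exact: lt_trans t0h1.
(* The clock is at least [tk] divided by the mass bound, and [1 - 1 / (2 alpha + 1) = 2 th] gives
   the power of [tk]. *)
have hA : c^-1 * tk `^ (2 * th) * x `^ (- (1 + eps / 2)) <= A tk w.
  rewrite -lee_fin clock_tk//.
  apply: le_trans (clock_ge T_gt0 (ltW tk0) kT _ hm); last first.
    apply: mulr_gt0; last by apply: powR_gt0; rewrite ln_tk.
    by apply: mulr_gt0 => //; exact: powR_gt0.
  have tkE : tk `^ (1 - 2 * th) = tk / tk `^ (2 * th).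
    by rewrite powRB ?(gt_eqF tk0) ?implybT// powRr1// ltW.
  rewrite lee_fin ln_tk th2 tkE -/p -/c powRN.
  rewrite le_eqVlt; apply/orP; left; apply/eqP.
  by field; rewrite !gt_eqF ?powR_gt0.
have [n [i [im hi]]] : exists n i, (i < (2 ^ n).+1)%N /\
    cc * tk `^ th * x `^ (- (1 / 2 + eps / 2)) <
    `|X u0 (grid tk n i) w - g u0|.
  have [n _ /existsNP[i /not_implyP[im /negP]]] := leave_tk kT hA.
  by rewrite -ltNge -ccE => hi; exists n, i.
have : 0 <= grid tk n i by apply: grid_ge0; exact: ltW.
have : grid tk n i <= tk by apply: grid_le; exact: ltW.
move: (grid tk n i) hi => s hi s_le s_ge0.
(* The path starts at [g u0], so the escape cannot occur at time 0, which the one-sided limit leaves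
   out. *)
have s0 : 0 < s.
  rewrite lt_neqAle s_ge0 andbT; apply/eqP => e.
  move: hi; rewrite -e start subrr normr0 ltNge => /negP; apply.
  by apply: mulr_ge0; [apply: mulr_ge0; [exact: ltW|]|]; exact: powR_ge0.
apply: (@le_trans _ _ (`|X u0 s w - g u0| /
      (s `^ th * ln (1 / s) `^ (- (1 / 2) - eps)))%:E); last first.
  apply: ereal_sup_ubound; exists s => //; apply: hr => //=.
  by rewrite sub0r normrN gtr0_norm// (le_lt_trans s_le).
rewrite lee_fin.
have s1 : s < 1 by exact: le_lt_trans tk1.
have Ls : x <= ln (1 / s).
  by rewrite -ln_tk ler_ln ?posrE ?divr_gt0// !div1r lef_pV2 ?posrE.
have Ls0 : 0 < ln (1 / s) by exact: lt_le_trans Ls.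
(* The escape may come earlier than [tk], but there the normalisation is no larger, so the quotient
   at [s] does not suffer. *)
have phi_le : s `^ th * ln (1 / s) `^ (- (1 / 2) - eps) <=
    tk `^ th * x `^ (- (1 / 2) - eps).
  apply: ler_pM; [exact: powR_ge0|exact: powR_ge0| |].
    by apply: ge0_ler_powR => //; rewrite nnegrE ltW.
  rewrite -opprD !powRN lef_pV2 ?posrE ?powR_gt0//.
  apply: ge0_ler_powR; rewrite ?nnegrE//; try exact: ltW.
  by rewrite addr_ge0// ltW.
have phi0 : 0 < s `^ th * ln (1 / s) `^ (- (1 / 2) - eps).
  by apply: mulr_gt0; exact: powR_gt0.
rewrite ler_pdivlMr//; apply: le_trans (ltW hi).
apply: le_trans (_ : M * (tk `^ th * x `^ (- (1 / 2) - eps)) <= _).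
  by rewrite ler_pM2l.
have ML : M <= cc * x `^ (eps / 2).
  rewrite -ler_pdivrMl// mulrC.
  have -> : M / cc = ((M / cc) `^ (2 / eps)) `^ (eps / 2).
    rewrite -powRrM (_ : 2 / eps * (eps / 2) = 1); last by field; rewrite gt_eqF.
    by rewrite powRr1// divr_ge0// ltW.
  apply: ge0_ler_powR => //; rewrite ?nnegrE ?powR_ge0//; last exact: ltW.
  by rewrite divr_ge0// ltW.
have -> : x `^ (- (1 / 2 + eps / 2)) =
    x `^ (eps / 2) * x `^ (- (1 / 2) - eps).
  rewrite -powRD ?(gt_eqF x0) ?implybT//.
  by have -> : - (1 / 2 + eps / 2) = eps / 2 + (- (1 / 2) - eps) by field.
rewrite (_ : cc * _ * _ = cc * x `^ (eps / 2) *
  (tk `^ th * x `^ (- (1 / 2) - eps))); last by ring.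
by apply: ler_wpM2r => //; apply: mulr_ge0; exact: powR_ge0.
Qed.

End main_asymptotics.

Theorem theorem1p3 (R : realType) (d : measure_display)
  (Omega : measurableType d) (P : probability Omega R)
  (T : R) (T_gt0 : 0 < T)
  (g : R -> R) (eps0 : R) (eps0_gt0 : 0 < eps0)
  (g_Lp : in_Lp01 (2 + eps0) g)
  (g_nondecreasing : nondecreasing01 g) (g_cadlag : cadlag01 g)
  (X : R -> R -> Omega -> R)
  (X_D : forall w : Omega, in_D01C T (fun u t => X u t w))
  (X_C1 : C1 P T X) (X_C2 : C2 P g X) (X_C3 : C3 P T X) (X_C4 : C4 P T X)
  (alpha : R) (alpha_gt : 1 / 2 < alpha)
  (u0 : R) (u0_in : u0 \in `]0, 1[)
  (C delta : R) (C_gt0 : 0 < C) (delta_gt0 : 0 < delta)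
  (delta_sub : `[u0 - delta, u0 + delta] `<=` `]0, 1[)
  (g_upper : forall u z : R, u \in `[u0 - delta, u0 + delta] ->
    Num.min 0 (u - u0) <= z -> z <= Num.max 0 (u - u0) ->
    `|g (u - z) - g u| <=
      C * `|u - u0| `^ Num.max (alpha - 1) 0 * `|z| `^ Num.min alpha 1)
  (g_lower : forall u : R, u \in `[u0 - delta, u0 + delta] ->
    `|g u - g u0| >= 1 / C * `|u - u0| `^ alpha) :
  forall eps : R, 0 < eps ->
    {ae P, forall w,
       fine (mass X u0 t w) /
         (t `^ (1 / (2 * alpha + 1)) * ln (1 / t) `^ (1 + eps))
       @[t --> 0^'+] --> (0 : R)} /\
    {ae P, forall w,
       limf_esup (fun t : R =>
         (`|X u0 t w - g u0| /
           (t `^ (alpha / (2 * alpha + 1)) *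
            ln (1 / t) `^ (- (1 / 2) - eps)))%:E) 0^'+ = +oo%E}.
Proof.
pose bracket_clock (uv : R * R) (B : R -> Omega -> R) :=
  uv.1 \in `]0, 1[ -> uv.2 \in `]0, 1[ ->
  is_bracket P T (natural_filtration X) (X uv.1) (X uv.2) B /\
  forall t, 0 <= t <= T ->
    {ae P, forall w, (B t w)%:E = clock T X uv.1 uv.2 t w}.
(* A version is chosen for every pair at once; outside the unit square the requirement is vacuous
   and the zero process fills in. *)
have /boolp.choice [A hA] : forall uv, exists B, bracket_clock uv B.
  move=> [u v]; rewrite /bracket_clock /=.
  have [u01|] := boolP (u \in `]0, 1[); last by exists (fun _ _ => 0).
  have [v01|] := boolP (v \in `]0, 1[); last by exists (fun _ _ => 0).
  have [B hB hclock] := X_C4 u v u01 v01.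
  by exists B => _ _; split=> // t tT; apply: hclock; rewrite in_itv.
pose B u v := A (u, v).
have B_bracket u v (u01 : u \in `]0, 1[) (v01 : v \in `]0, 1[) :
    is_bracket P T (natural_filtration X) (X u) (X v) (B u v).
  by have [] := hA (u, v) u01 v01.
have B_clock u v t (u01 : u \in `]0, 1[) (v01 : v \in `]0, 1[) (tT : 0 <= t <= T) :
    {ae P, forall w, (B u v t w)%:E = clock T X u v t w}.
  by have [_] := hA (u, v) u01 v01; exact.
move=> eps eps_gt0.
have c_gt0 p : 0 < mass_const alpha p by exact: mass_const_gt0.
have c_bound p (p1 : 1 < p) := mass_bound T_gt0 X_D X_C1 X_C2 X_C3 B_bracket B_clock
  alpha_gt u0_in C_gt0 delta_gt0 delta_sub g_upper g_lower p1.
split.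
  exact: (mass_limit c_gt0 c_bound eps_gt0).
apply: (position_limsup T_gt0 X_C1 X_C2 u0_in alpha_gt c_gt0 c_bound
  (B_bracket _ _ u0_in u0_in) _ _ eps_gt0).
- by move=> t; exact: B_clock.
- by move=> s t; exact: (A_diag_mono B_clock).
Qed.
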